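(* Let $\varepsilon>0$ and $q\in(0,1]$. Then there is an expander sequence $\mathcal G=(G_n)_{n\in\mathbb N}$ and a sequence of graphs $(\tilde G_n)_{n\in\mathbb N}$ such that each $\tilde G_n$ is obtained by deleting edges of $G_n$ such that each vertex keeps at least a $(1-\varepsilon)$ fraction of its edges, and whp (a) $T_{push}(\tilde G_n,q)\ge c_{push}(q)\log n+\frac{\varepsilon}{2q}\log n+o(\log n)$; (b) $T_{pp}(\tilde G_n,q)\ge c_{pp}(q)\log n+\left(\frac{\varepsilon}{8q}-\frac{\varepsilon q^3}{5}\right)\log n+o(\log n)$.
   Context: Rumour spreading protocols on a connected graph with $n$ vertices, one vertex initially informed, synchronous rounds; each message transmission succeeds independently with probability $q\in(0,1]$. push: in each round every informed vertex chooses a neighbour independently and uniformly at random and (if the transmission succeeds) informs it. push\&pull (pp): in each round every vertex chooses a neighbour independently and uniformly at random, and if one of the two is informed (and the transmission succeeds) both become informed. $T_{\mathcal P}(G,q)$ is the number of rounds until all vertices are informed. $c_{push}(q)=\frac{1}{\log(1+q)}+\frac1q$, $c_{pp}(q)=\frac{1}{\log(1+2q)}+\frac{1}{q-\log(1-q)}$ for $q\in(0,1)$ and $c_{\mathcal P}(1)=\lim_{q\to1}c_{\mathcal P}(q)$; natural log. An expander sequence is a sequence $(G_n)$ of connected graphs, $G_n$ on $n$ vertices with minimum degree $\delta_n$, maximum degree $\Delta_n$, and $\lambda_n=\max\{|\mu_2|,|\mu_n|\}$ (from the adjacency eigenvalues $\mu_1\ge\dots\ge\mu_n$), with $\Delta_n/\delta_n=1+o(1)$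 and $\lambda_n=o(\Delta_n)$. ''Keeps at least a $(1-\varepsilon)$ fraction'' means $d_{\tilde G_n}(v)\ge(1-\varepsilon)d_{G_n}(v)$. whp means with probability $1-o(1)$ as $n\to\infty$. $a\ge b-o(f)$-type statements: $a\ge b+o(f)$ is understood as $a\ge b-h$ for some positive $h=o(f)$. *)

(* Defs.v *)
From HB Require Import structures.
From mathcomp Require Import all_boot all_order all_algebra.
From mathcomp Require Import all_classical all_reals all_analysis.
Set Implicit Arguments. Unset Strict Implicit. Unset Printing Implicit Defensive.
Import Order.TTheory GRing.Theory Num.Theory.
Import numFieldNormedType.Exports.
Local Open Scope ring_scope.

Record graph (n : nat) := Graph {
  adj : rel 'I_n;
  adj_sym : symmetric adj;
  adj_irr : irreflexive adj }.

Definition deg n (G : graph n) (v : 'I_n) : nat := #|[set u | adj G v u]|.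
Definition maxdeg n (G : graph n) : nat := (\max_(v : 'I_n) deg G v)%N.
Definition mindeg n (G : graph n) : nat := \big[minn/n]_(v : 'I_n) deg G v.

Definition connected n (G : graph n) : Prop :=
  forall x y : 'I_n, connect (adj G) x y.

Definition keeps_fraction (R : realType) (eps : R) n (G Gt : graph n) : Prop :=
  (forall u v, adj Gt u v -> adj G u v) /\
  (forall v, (1 - eps) * (deg G v)%:R <= (deg Gt v)%:R).

Definition adjmx (R : realType) n (G : graph n) : 'M[R]_n :=
  \matrix_(i, j) (adj G i j)%:R.

Definition eigenvalues_sorted (R : realType) n (A : 'M[R]_n) (s : seq R) : Prop :=
  sorted (fun x y : R => y <= x) s /\
  char_poly A = \prod_(x <- s) ('X - x%:P).

Definition second_eig (R : realType) n (G : graph n) (lam : R) : Prop :=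
  exists s : seq R, eigenvalues_sorted (adjmx R G) s /\
    lam = Num.max `|s`_1| `|s`_n.-1|.

Definition expander_seq (R : realType) (G : forall n, graph n) : Prop :=
  (forall n, connected (G n)) /\
  ((fun n => (maxdeg (G n))%:R / (mindeg (G n))%:R : R) @ \oo --> (1 : R))%classic /\
  exists lam : nat -> R, (forall n, second_eig (G n) (lam n)) /\
    ((fun n => lam n / (maxdeg (G n))%:R) @ \oo --> (0 : R))%classic.

(* In every round every vertex v chooses a neighbour u uniformly at random
   and independently a success bit b (true with probability q); an isolated
   vertex makes no call (we encode this as the dummy choice (v,false)). *)
Definition choice_prob (R : realType) (q : R) n (G : graph n) (v : 'I_n)
    (c : 'I_n * bool) : R :=
  if deg G v == 0%N then ((c.1 == v) && ~~ c.2)%:R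
  else (adj G v c.1)%:R / (deg G v)%:R * (if c.2 then q else 1 - q).

Definition round_weight (R : realType) (q : R) n (G : graph n)
    (f : {ffun 'I_n -> 'I_n * bool}) : R :=
  \prod_(v : 'I_n) choice_prob q G v (f v).

Definition step_push n (S : {set 'I_n}) (f : {ffun 'I_n -> 'I_n * bool}) :
    {set 'I_n} :=
  S :|: [set u | [exists v, (v \in S) && (f v == (u, true))]].

Definition step_pp n (S : {set 'I_n}) (f : {ffun 'I_n -> 'I_n * bool}) :
    {set 'I_n} :=
  S :|: [set u | [exists v, (f v).2 &&
           (((v \in S) && ((f v).1 == u)) || (((f v).1 \in S) && (v == u)))]].

Definition protocol := forall n, {set 'I_n} -> {ffun 'I_n -> 'I_n * bool} -> {set 'I_n}.
Definition push : protocol := step_push.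
Definition pp : protocol := step_pp.

Fixpoint law (R : realType) (P : protocol) (q : R) n (G : graph n) (v0 : 'I_n)
    (t : nat) (S' : {set 'I_n}) : R :=
  match t with
  | 0%N => (S' == [set v0])%:R
  | t'.+1 => \sum_(S : {set 'I_n}) law P q G v0 t' S *
              \sum_(f : {ffun 'I_n -> 'I_n * bool} | P n S f == S')
                 round_weight q G f
  end.

(* T = number of rounds until all vertices are informed ([set: 'I_n] is
   absorbing, so T <= t iff the informed set at time t is everything). *)
Definition prob_T_eq (R : realType) (P : protocol) (q : R) n (G : graph n)
    (v0 : 'I_n) (t : nat) : R :=
  law P q G v0 t [set: 'I_n] -
  (if t is t'.+1 then law P q G v0 t' [set: 'I_n] else 0).

(* Pr[ T_P(G,q) >= x ] for real x (T may be infinite). *)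
Definition prob_T_ge (R : realType) (P : protocol) (q : R) n (G : graph n)
    (v0 : 'I_n) (x : R) : R :=
  1 - \sum_(t < (Num.truncn x).+1 | (t%:R : R) < x) prob_T_eq P q G v0 t.

(* constants; at q = 1 the limit values *)
Definition c_push (R : realType) (q : R) : R :=
  if q < 1 then (ln (1 + q))^-1 + q^-1 else (ln 2)^-1 + 1.
Definition c_pp (R : realType) (q : R) : R :=
  if q < 1 then (ln (1 + 2 * q))^-1 + (q - ln (1 - q))^-1 else (ln 3)^-1.

(* whp lower bound  T_P(G_n,q) >= f n + o(log n), uniformly in the start
   vertex: there is a positive h = o(log n) such that
   Pr[T >= f n - h n] -> 1. *)
Definition whp_lower (R : realType) (P : protocol) (q : R)
    (G : forall n, graph n) (f : nat -> R) : Prop :=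
  exists h : nat -> R, (forall n, 0 < h n) /\
    ((fun n => h n / ln (n%:R)) @ \oo --> (0 : R))%classic /\
    forall e : R, 0 < e -> (\forall n \near \oo,
      forall v0 : 'I_n, 1 - e <= prob_T_ge P q (G n) v0 (f n - h n))%classic.

(* Main.v *)
(* Take G_n complete. For eps >= 1 all edges can be deleted. Otherwise let U be
   the first delta n vertices, M the first eps n vertices (so U is inside M), and
   delete the edges between U and M, those inside U included: vertices of U lose
   a fraction eps of their edges, all others at most a fraction delta.
   Early phase: a round multiplies the expected number of informed vertices by at
   most 1 + q (push) or 1 + 2q + O(delta) (pp), so until time
   (1/log(1+q) - s) log n, resp. (1/log(1+2q) - s) log n, at least half of U is
   uninformed whp.
   Late phase: even if every other vertex is informed, a vertex of U escapes a
   round with probability about exp(-q(1-eps)), times 1 - q for pp, since its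
   (1-eps) n neighbours have full degree. Two vertices of U escape with negatively
   correlated events, so a second moment bound shows that U is not fully informed
   before time about log n / (q(1-eps)), resp. log n / (q(1-eps) - log(1-q)).
   Both denominators leave room for the slack s and for delta > 0.
   For pp and q = 1 the extra term is negative and the early phase suffices. *)
Require Import Defs.
From HB Require Import structures.
From mathcomp Require Import all_boot all_order all_algebra.
From mathcomp Require Import all_classical all_reals all_analysis.
From mathcomp Require Import ring lra.
Import Order.TTheory GRing.Theory Num.Theory.
Import numFieldNormedType.Exports.
Local Open Scope ring_scope.
Set Implicit Arguments. Unset Strict Implicit. Unset Printing Implicit Defensive.

(** * Expectations over a round and over the law of the process *)

Definition round_mean (R : realType) (q : R) n (G : graph n)
    (X : {ffun 'I_n -> 'I_n * bool} -> R) : R :=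
  \sum_f round_weight q G f * X f.

Definition law_mean (R : realType) (P : protocol) (q : R) n (G : graph n)
    (v0 : 'I_n) (t : nat) (phi : {set 'I_n} -> R) : R :=
  \sum_S law P q G v0 t S * phi S.

(** Since 0^-1 = 0, the formula also covers an isolated vertex, whose dummy choice never carries the
    bit [true]. *)
Lemma choice_prob_true (R : realType) (q : R) n (G : graph n) v u :
  choice_prob q G v (u, true) = q * ((adj G v u)%:R / (deg G v)%:R).
Proof.
rewrite /choice_prob /=; case: eqP => [->|_]; last by rewrite mulrC.
by rewrite andbF invr0 !mulr0.
Qed.

Lemma sum_call_prob (R : realType) n (G : graph n) v :
  \sum_u (adj G v u)%:R / (deg G v)%:R = (deg G v != 0%N)%:R :> R.
Proof.
rewrite -mulr_suml -natr_sum.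
have -> : (\sum_u adj G v u)%N = deg G v.
  rewrite /deg -sum1_card [RHS]big_mkcond /=; apply: eq_bigr => u _.
  by rewrite inE; case: (adj G v u).
by have [->|d0] := eqVneq (deg G v) 0%N; rewrite ?invr0 ?mulr0// divff// pnatr_eq0.
Qed.

Lemma choice_prob_ge0 (R : realType) (q : R) n (G : graph n) v c :
  0 <= q -> q <= 1 -> 0 <= choice_prob q G v c.
Proof.
move=> q0 q1; rewrite /choice_prob; case: ifP => // _.
by rewrite mulr_ge0 ?divr_ge0//; case: ifP => //; rewrite subr_ge0.
Qed.

Lemma sum_choices (R : realType) n (F : 'I_n * bool -> R) :
  \sum_c F c = \sum_u (F (u, true) + F (u, false)).
Proof.
transitivity (\sum_u \sum_b F (u, b)).
  by rewrite pair_big; apply: eq_bigr => -[].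
by apply: eq_bigr => u _; exact: (@big_bool R 0 +%R).
Qed.

Lemma sum_choice_prob_true (R : realType) (q : R) n (G : graph n) v :
  \sum_c choice_prob q G v c * c.2%:R = q * (deg G v != 0%N)%:R.
Proof.
rewrite -sum_call_prob mulr_sumr sum_choices.
by apply: eq_bigr => u _; rewrite /= mulr1 mulr0 addr0 choice_prob_true.
Qed.

Lemma sum_choice_prob (R : realType) (q : R) n (G : graph n) v :
  \sum_c choice_prob q G v c = 1.
Proof.
rewrite sum_choices.
have [d0|d0] := eqVneq (deg G v) 0%N.
  rewrite (bigD1 v)//= big1 ?addr0 => [|u /negPf uv]; rewrite /choice_prob /= d0 !eqxx /=.
    by rewrite add0r.
  by rewrite uv addr0.
transitivity ((deg G v != 0%N)%:R : R); last by rewrite d0.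
rewrite -sum_call_prob.
apply: eq_bigr => u _; rewrite /choice_prob /= (negPf d0).
by rewrite -mulrDr addrC subrK mulr1.
Qed.

(** Independence of the choices: expanding a product of sums gives one term for each [f]. *)
Lemma round_mean_prod (R : realType) (q : R) n (G : graph n)
    (F : 'I_n -> 'I_n * bool -> R) :
  round_mean q G (fun f => \prod_v F v (f v)) =
  \prod_v \sum_c choice_prob q G v c * F v c.
Proof.
rewrite /round_mean bigA_distr_bigA; apply: eq_bigr => f _.
by rewrite /round_weight -big_split.
Qed.

Lemma round_mean_choice (R : realType) (q : R) n (G : graph n) v
    (F : 'I_n * bool -> R) :
  round_mean q G (fun f => F (f v)) = \sum_c choice_prob q G v c * F c.
Proof.
(* The other vertices get the factor 1, so that the product formula applies. *)
pose F' w c := if w == v then F c else 1.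
transitivity (round_mean q G (fun f => \prod_w F' w (f w))).
  apply: eq_bigr => f _; congr (_ * _).
  rewrite (bigD1 v)//= /F' eqxx big1 ?mulr1// => w /negPf ->//.
rewrite round_mean_prod (bigD1 v)//= [X in _ * X]big1 ?mulr1 => [|w /negPf wv].
  by apply: eq_bigr => c _; rewrite /F' eqxx.
rewrite -[RHS](sum_choice_prob q G w).
by apply: eq_bigr => c _; rewrite /F' wv mulr1.
Qed.

Lemma round_mean_sum (R : realType) (q : R) n (G : graph n) (I : finType)
    (A : pred I) (X : I -> {ffun 'I_n -> 'I_n * bool} -> R) :
  round_mean q G (fun f => \sum_(i | A i) X i f) =
  \sum_(i | A i) round_mean q G (X i).
Proof.
by rewrite /round_mean exchange_big; apply: eq_bigr => f _; rewrite mulr_sumr.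
Qed.

Lemma round_meanD (R : realType) (q : R) n (G : graph n) X Y :
  round_mean q G (fun f => X f + Y f) =
  round_mean q G X + round_mean q G Y.
Proof.
by rewrite /round_mean -big_split; apply: eq_bigr => f _; rewrite mulrDr.
Qed.

Lemma round_meanZ (R : realType) (q : R) n (G : graph n) a X :
  round_mean q G (fun f => a * X f) = a * round_mean q G X.
Proof. by rewrite /round_mean mulr_sumr; apply: eq_bigr => f _; rewrite mulrCA. Qed.

Lemma round_mean_cst (R : realType) (q : R) n (G : graph n) a :
  round_mean q G (fun=> a) = a.
Proof.
rewrite -[RHS]mulr1 -(_ : round_mean q G (fun=> 1) = 1).
  by rewrite -round_meanZ; apply: eq_bigr => f _; rewrite mulr1.
transitivity (round_mean q G (fun f => \prod_(v : 'I_n) 1)).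
  by apply: eq_bigr => f _; rewrite big1.
rewrite (round_mean_prod _ _ (fun _ _ => 1)) big1// => v _.
by rewrite -[RHS](sum_choice_prob q G v); apply: eq_bigr => c _; rewrite mulr1.
Qed.

Lemma round_weight_ge0 (R : realType) (q : R) n (G : graph n) f :
  0 <= q -> q <= 1 -> 0 <= round_weight q G f.
Proof. by move=> q0 q1; apply: prodr_ge0 => v _; exact: choice_prob_ge0. Qed.

Lemma ler_round_mean (R : realType) (q : R) n (G : graph n) X Y :
  0 <= q -> q <= 1 -> (forall f, X f <= Y f) ->
  round_mean q G X <= round_mean q G Y.
Proof.
by move=> q0 q1 XY; apply: ler_sum => f _; rewrite ler_wpM2l ?round_weight_ge0.
Qed.

Lemma law_mean0 (R : realType) P (q : R) n (G : graph n) v0 phi :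
  law_mean P q G v0 0 phi = phi [set v0].
Proof.
rewrite /law_mean (bigD1 [set v0])//= eqxx mul1r big1 ?addr0// => S /negPf ->.
by rewrite mul0r.
Qed.

(** Grouping the choices [f] by the informed set that they produce turns the forward recursion of
    [law] into a mean over the last round. *)
Lemma law_meanS (R : realType) P (q : R) n (G : graph n) v0 t phi :
  law_mean P q G v0 t.+1 phi =
  law_mean P q G v0 t (fun S => round_mean q G (fun f => phi (P n S f))).
Proof.
rewrite /law_mean /=; under eq_bigr do rewrite mulr_suml.
rewrite exchange_big; apply: eq_bigr => S _ /=.
under eq_bigr do rewrite -mulrA; rewrite -mulr_sumr; congr (_ * _).
rewrite /round_mean [RHS](partition_big (P n S) xpredT)//=.
apply: eq_bigr => S' _; rewrite mulr_suml.
by apply: eq_bigr => f /eqP ->.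
Qed.

Lemma law_ge0 (R : realType) P (q : R) n (G : graph n) v0 t S :
  0 <= q -> q <= 1 -> 0 <= law P q G v0 t S.
Proof.
move=> q0 q1; elim: t S => [|t IH] S //=.
by apply: sumr_ge0 => S' _; rewrite mulr_ge0 ?sumr_ge0// => f _; rewrite round_weight_ge0.
Qed.

Lemma ler_law_mean (R : realType) P (q : R) n (G : graph n) v0 t phi psi :
  0 <= q -> q <= 1 -> (forall S, phi S <= psi S) ->
  law_mean P q G v0 t phi <= law_mean P q G v0 t psi.
Proof.
by move=> q0 q1 le; apply: ler_sum => f _; rewrite ler_wpM2l ?law_ge0.
Qed.

Lemma law_meanD (R : realType) P (q : R) n (G : graph n) v0 t phi psi :
  law_mean P q G v0 t (fun S => phi S + psi S) =
  law_mean P q G v0 t phi + law_mean P q G v0 t psi.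
Proof.
by rewrite /law_mean -big_split; apply: eq_bigr => f _; rewrite mulrDr.
Qed.

Lemma law_meanZ (R : realType) P (q : R) n (G : graph n) v0 t a phi :
  law_mean P q G v0 t (fun S => a * phi S) = a * law_mean P q G v0 t phi.
Proof. by rewrite /law_mean mulr_sumr; apply: eq_bigr => f _; rewrite mulrCA. Qed.

Lemma law_mean_cst (R : realType) P (q : R) n (G : graph n) v0 t a :
  law_mean P q G v0 t (fun=> a) = a.
Proof.
elim: t => [|t IH]; first by rewrite law_mean0.
by rewrite law_meanS; under eq_fun do rewrite round_mean_cst.
Qed.

Lemma law_setT (R : realType) P (q : R) n (G : graph n) v0 t :
  law P q G v0 t [set: 'I_n] = law_mean P q G v0 t (fun S => (S == [set: 'I_n])%:R).
Proof.
rewrite /law_mean (bigD1 [set: 'I_n])//= eqxx mulr1 big1 ?addr0// => S /negPf ->.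
by rewrite mulr0.
Qed.

(** Conditions on the first round, whereas [law] peels off the last one: the late phase is an
    induction from an arbitrary informed set. *)
Fixpoint step_mean (R : realType) (P : protocol) (q : R) n (G : graph n)
    (t : nat) (phi : {set 'I_n} -> R) (S : {set 'I_n}) : R :=
  if t is t'.+1 then round_mean q G (fun f => step_mean P q G t' phi (P n S f))
  else phi S.

(** Markov property at time [t1]. *)
Lemma law_mean_step (R : realType) P (q : R) n (G : graph n) v0 t1 t2 phi :
  law_mean P q G v0 (t1 + t2) phi =
  law_mean P q G v0 t1 (step_mean P q G t2 phi).
Proof.
elim: t2 t1 => [|t2 IH] t1; first by rewrite addn0.
by rewrite addnS -addSn IH law_meanS.
Qed.

Definition increasing (P : protocol) :=
  forall n (S : {set 'I_n}) f, S \subset P n S f.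

Lemma law_setT_mono (R : realType) P (q : R) n (G : graph n) v0 t :
  0 <= q -> q <= 1 -> increasing P ->
  law P q G v0 t [set: 'I_n] <= law P q G v0 t.+1 [set: 'I_n].
Proof.
move=> q0 q1 incP; rewrite !law_setT law_meanS; apply: ler_law_mean => // S.
have [->|_] := eqVneq S [set: 'I_n].
  rewrite -[leLHS](round_mean_cst q G 1); apply: ler_round_mean => // f.
  by have := incP _ [set: 'I_n] f; rewrite finset.subTset => ->.
by rewrite -[leLHS](round_mean_cst q G); exact: ler_round_mean.
Qed.

(** Integers below [x] are at most [t], and the probabilities of T = i for i <= t telescope to the
    probability of full information at time [t]. *)
Lemma prob_T_ge_lower (R : realType) P (q : R) n (G : graph n) v0 (x : R) t :
  0 <= q -> q <= 1 -> increasing P -> x <= t.+1%:R ->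
  1 - law P q G v0 t [set: 'I_n] <= prob_T_ge P q G v0 x.
Proof.
move=> q0 q1 incP xt; rewrite /prob_T_ge lerB//.
set d := prob_T_eq _ _ _ _.
have d0 i : 0 <= d i.
  rewrite /d /prob_T_eq; case: i => [|i]; first by rewrite subr0 law_ge0.
  by rewrite subr_ge0 law_setT_mono.
have dT : \sum_(i < t.+1) d i = law P q G v0 t [set: 'I_n].
  elim: (t) => [|s IH]; first by rewrite big_ord_recl big_ord0 addr0 /d /prob_T_eq subr0.
  by rewrite big_ord_recr/= IH /d /prob_T_eq addrC subrK.
rewrite -dT -(big_mkord (fun i => i%:R < x) d) -(big_mkord xpredT d).
(* Both sums are extended to a common range, where they compare term by term. *)
rewrite [leRHS](big_nat_widen _ _ (maxn (Num.truncn x).+1 t.+1)) ?leq_maxr//.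
rewrite [leLHS](big_nat_widen _ _ (maxn (Num.truncn x).+1 t.+1)) ?leq_maxl//.
rewrite big_mkcond [leRHS]big_mkcond /=; apply: ler_sum => i _.
case: ifP => [/andP[ix _]|_]; last by case: ifP.
by rewrite -(ltr_nat R) (lt_le_trans ix xt).
Qed.

(** * Early phase: exponential growth of the informed set *)

(** The boolean treats both protocols at once; it switches on the contributions of pull calls. *)
Definition rumour (pull : bool) : protocol := if pull then pp else push.

Lemma rumour_increasing pull : increasing (rumour pull).
Proof. by case: pull => n S f; apply: finset.subsetUl. Qed.

(** A new vertex is the target of a successful call from [S] or, under pull, the maker of a
    successful call into [S]. *)
Lemma card_rumour_step (pull : bool) n (S : {set 'I_n}) f :
  (#|rumour pull S f| <= #|S| + \sum_(v in S) (f v).2 +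
     \sum_(v in S) \sum_w pull && (f w == (v, true)))%N.
Proof.
have pushed : (#|[set (f v).1 | v in [set v in S | (f v).2]]| <=
               \sum_(v in S) (f v).2)%N.
  apply: leq_trans (leq_imset_card _ _) _; rewrite -sum1_card big_mkcond.
  rewrite [leqRHS]big_mkcond; apply: leq_sum => v _; rewrite !inE.
  by case: (v \in S); case: (f v).2.
have pulled : (#|[set w | (f w).2 && ((f w).1 \in S)]| <=
               \sum_(v in S) \sum_w (f w == (v, true)))%N.
  rewrite exchange_big -sum1_card big_mkcond; apply: leq_sum => w _.
  rewrite inE; case: ifP => // /andP[f2 f1].
  by rewrite (bigD1 (f w).1)//= [f w]surjective_pairing f2 eqxx.
case: pull => /=.
- apply: leq_trans (_ : #|S :|: ([set (f v).1 | v in [set v in S | (f v).2]]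
    :|: [set w | (f w).2 && ((f w).1 \in S)])| <= _)%N; last first.
    rewrite -addnA; apply: leq_trans (leq_card_setU _ _) _; rewrite leq_add2l.
    by apply: leq_trans (leq_card_setU _ _) _; exact: leq_add.
  apply/subset_leq_card/finset.setUS/fintype.subsetP => u; rewrite !inE.
  case/existsP => v /andP[f2 /orP[/andP[vS /eqP fu]|/andP[fS /eqP <-]]].
    by apply/orP; left; apply/imsetP; exists v; rewrite ?inE ?vS.
  by rewrite f2 fS orbT.
- apply: leq_trans (leq_addr _ _).
  apply: leq_trans (_ : #|S :|: [set (f v).1 | v in [set v in S | (f v).2]]| <= _)%N; last first.
    by apply: leq_trans (leq_card_setU _ _) _; rewrite leq_add2l.
  apply/subset_leq_card/finset.setUS/fintype.subsetP => u; rewrite !inE.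
  case/existsP => v /andP[vS /eqP fu]; apply/imsetP; exists v; rewrite ?fu//.
  by rewrite inE vS fu.
Qed.

(** Here [g] bounds the expected number of vertices that one informed vertex adds: at most q by its
    own call and, under pull, the expected number of successful calls that reach it. *)
Lemma mean_card_rumour_step (R : realType) (q : R) (pull : bool) n (G : graph n) S (g : R) :
  0 <= q -> q <= 1 ->
  (forall v, q * (deg G v != 0%N)%:R +
     pull%:R * (q * \sum_w (adj G w v)%:R / (deg G w)%:R) <= g) ->
  round_mean q G (fun f => #|rumour pull S f|%:R) <= (1 + g) * #|S|%:R.
Proof.
move=> q0 q1 gP.
pose X f : R := #|S|%:R + (\sum_(v in S) (f v : 'I_n * bool).2%:R) +
  \sum_(v in S) \sum_w pull%:R * (f w == (v, true))%:R.
apply: (@le_trans _ _ (round_mean q G X)).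
  apply: ler_round_mean => // f.
  rewrite /X; under [X in _ + X]eq_bigr do under eq_bigr do rewrite -natrM mulnb.
  under [X in _ + X]eq_bigr do rewrite -natr_sum.
  by rewrite -!natr_sum -!natrD ler_nat card_rumour_step.
rewrite /X !round_meanD round_mean_cst mulrDl mul1r -addrA lerD2l.
rewrite !round_mean_sum -big_split /= mulr_natr -sumr_const; apply: ler_sum => v _.
rewrite (round_mean_choice q G v (fun c => c.2%:R)) sum_choice_prob_true.
apply: le_trans (gP v); rewrite lerD2l round_mean_sum !mulr_sumr.
apply: ler_sum => w _; rewrite round_meanZ.
rewrite (round_mean_choice q G w (fun c => (c == (v, true))%:R)).
rewrite (bigD1 (v, true))//= eqxx mulr1 big1 ?addr0; last first.
  by move=> c /negPf ->; rewrite mulr0.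
by rewrite choice_prob_true.
Qed.

Lemma law_mean_card (R : realType) (q : R) (pull : bool) n (G : graph n) v0 t (g : R) :
  0 <= q -> q <= 1 -> 0 <= 1 + g ->
  (forall v, q * (deg G v != 0%N)%:R +
     pull%:R * (q * \sum_w (adj G w v)%:R / (deg G w)%:R) <= g) ->
  law_mean (rumour pull) q G v0 t (fun S => #|S|%:R) <= (1 + g) ^+ t.
Proof.
move=> q0 q1 g0 gP; elim: t => [|t IH]; first by rewrite law_mean0 cards1.
rewrite law_meanS.
apply: (@le_trans _ _ (law_mean (rumour pull) q G v0 t (fun S => (1 + g) * #|S|%:R))).
  by apply: ler_law_mean => // S; exact: mean_card_rumour_step.
by rewrite law_meanZ exprS ler_wpM2l.
Qed.

(** Worst case, with everyone but [u] informed: under pull, any successful call by [u] itself would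
    then bring it the rumour. *)
Definition avoids (pull : bool) n (u v : 'I_n) (c : 'I_n * bool) : bool :=
  (c != (u, true)) && ~~ [&& pull, v == u & c.2].

(* Depends only on the choices of the round: [u] escapes even if all the other
   vertices are informed. *)
Definition escapes (pull : bool) n (f : {ffun 'I_n -> 'I_n * bool}) (u : 'I_n) : bool :=
  [forall v, avoids pull u v (f v)].

Lemma escapesP (pull : bool) n (S : {set 'I_n}) f u :
  u \notin S -> escapes pull f u -> u \notin rumour pull S f.
Proof.
rewrite /escapes /avoids => uS /forallP esc; apply/negP; case: pull esc => esc; rewrite !inE (negPf uS)/=.
  case/existsP => v /andP[f2 /orP[/andP[_ /eqP fu]|/andP[_ /eqP vu]]].
    by have := esc v; rewrite [f v]surjective_pairing f2 fu eqxx.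
  by have := esc v; rewrite vu eqxx -vu f2 /= andbF.
by case/existsP => v /andP[_ fu]; have := esc v; rewrite fu.
Qed.

(** The last factor stands for the failure of the call made by [u] itself, which pull requires. *)
Definition escape_prob (R : realType) (q : R) (pull : bool) n (G : graph n) u : R :=
  (\prod_v (1 - q * ((adj G v u)%:R / (deg G v)%:R))) * (1 - pull%:R * q).

Lemma sum_choice_prob_neg (R : realType) (q : R) n (G : graph n) v :
  deg G v != 0%N -> \sum_c choice_prob q G v c * (~~ c.2)%:R = 1 - q.
Proof.
move=> d0; have := sum_choice_prob_true q G v; rewrite d0 mulr1 => qE.
rewrite -[in RHS]qE -[X in _ = X - _](sum_choice_prob q G v) -sumrB.
apply: eq_bigr => c _; rewrite -[X in X - _]mulr1 -mulrBr.
by case: c.2; rewrite ?subrr ?subr0.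
Qed.

(** * Late phase: escaping vertices *)

Lemma sum_choice_prob_miss (R : realType) (q : R) n (G : graph n) v u :
  \sum_c choice_prob q G v c * (c != (u, true))%:R =
  1 - q * ((adj G v u)%:R / (deg G v)%:R).
Proof.
rewrite -choice_prob_true -[X in _ = X - _](sum_choice_prob q G v).
rewrite (bigD1 (u, true))//= eqxx mulr0 add0r.
rewrite [X in _ = X - _](bigD1 (u, true))//= addrAC subrr add0r.
by apply: eq_bigr => c ->; rewrite mulr1.
Qed.

Lemma sum_choice_prob_avoids (R : realType) (q : R) (pull : bool) n (G : graph n) u v :
  deg G u != 0%N ->
  \sum_c choice_prob q G v c * (avoids pull u v c)%:R =
  (1 - q * ((adj G v u)%:R / (deg G v)%:R)) *
  (if v == u then 1 - pull%:R * q else 1).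
Proof.
move=> du; rewrite /avoids; case: eqVneq => [->|vu] /=; last first.
  rewrite mulr1 -sum_choice_prob_miss; apply: eq_bigr => c _.
  by rewrite andbF andbT.
(* No vertex calls itself, so at v = u only the pull condition matters. *)
rewrite adj_irr mul0r mulr0 subr0 mul1r; case: pull => /=.
  rewrite mul1r -(sum_choice_prob_neg q du); apply: eq_bigr => -[w b] _ /=.
  by case: b; rewrite ?andbF// xpair_eqE andbF.
have := sum_choice_prob_miss q G u u; rewrite adj_irr mul0r mulr0 !subr0 => missE.
rewrite mul0r subr0 -[RHS]missE.
by apply: eq_bigr => c _; rewrite andbT.
Qed.

Lemma escapesE (R : realType) (pull : bool) n f (u : 'I_n) :
  (escapes pull f u)%:R = \prod_v (avoids pull u v (f v))%:R :> R.
Proof.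
rewrite /escapes; case: forallP => [esc|esc].
  by rewrite big1// => v _; rewrite esc.
have [v nv] : exists v, ~~ avoids pull u v (f v).
  by apply/existsP; rewrite -negb_forall; apply/forallP.
by rewrite (bigD1 v)//= (negPf nv) mul0r.
Qed.

Lemma mean_escapes (R : realType) (q : R) (pull : bool) n (G : graph n) u :
  deg G u != 0%N ->
  round_mean q G (fun f => (escapes pull f u)%:R) = escape_prob q pull G u.
Proof.
move=> du; transitivity (round_mean q G (fun f => \prod_v (avoids pull u v (f v))%:R)).
  by apply: eq_bigr => f _; rewrite escapesE.
rewrite (round_mean_prod q G (fun v c => (avoids pull u v c)%:R)).
under eq_bigr do rewrite sum_choice_prob_avoids//.
rewrite big_split /= /escape_prob; congr (_ * _).
by rewrite -big_mkcond big_pred1_eq.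
Qed.

(* A vertex that pushes to [u] does not push to [u'] in the same round. *)
Lemma mean_escapes2 (R : realType) (q : R) (pull : bool) n (G : graph n) u u' :
  0 <= q -> q <= 1 -> deg G u != 0%N -> deg G u' != 0%N ->
  u != u' -> ~~ adj G u u' ->
  round_mean q G (fun f => (escapes pull f u)%:R * (escapes pull f u')%:R) <=
  escape_prob q pull G u * escape_prob q pull G u'.
Proof.
move=> q0 q1 du du' uu' nadj.
rewrite -!mean_escapes//.
have -> : round_mean q G (fun f => (escapes pull f u)%:R * (escapes pull f u')%:R) =
  round_mean q G (fun f => \prod_v ((avoids pull u v (f v))%:R * (avoids pull u' v (f v))%:R)).
  by apply: eq_bigr => f _; rewrite !escapesE -big_split.
have E w : round_mean q G (fun f => (escapes pull f w)%:R) =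
   \prod_v \sum_c choice_prob q G v c * (avoids pull w v c)%:R.
  rewrite -round_mean_prod; apply: eq_bigr => f _; by rewrite escapesE.
rewrite !E (round_mean_prod q G (fun v c => (avoids pull u v c)%:R * (avoids pull u' v c)%:R)).
rewrite -big_split /=; apply: ler_prod => v _; apply/andP; split.
  by apply: sumr_ge0 => c _; rewrite mulr_ge0 ?choice_prob_ge0.
(* If [v] is one of the two vertices, it cannot push to the other one, to which it is not adjacent;
   one factor is then 1. *)
have key w w' : ~~ adj G w w' -> deg G w != 0%N -> deg G w' != 0%N -> w != w' -> v = w ->
    \sum_c choice_prob q G v c * ((avoids pull w v c)%:R * (avoids pull w' v c)%:R) <=
    (\sum_c choice_prob q G v c * (avoids pull w v c)%:R) *
    (\sum_c choice_prob q G v c * (avoids pull w' v c)%:R).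
  move=> nww' dw dw' ww' ->; rewrite [X in _ <= _ * X]sum_choice_prob_avoids//.
  rewrite (negPf nww') (negPf ww') mul0r mulr0 subr0 !mulr1.
  apply: ler_sum => c _; rewrite ler_wpM2l ?choice_prob_ge0//.
  by case: avoids; case: avoids; rewrite ?mulr1 ?mulr0.
have [vu|vu] := eqVneq v u; first exact: key.
have [vu'|vu'] := eqVneq v u'.
  rewrite [leRHS]mulrC; under eq_bigr do rewrite [_%:R * _%:R]mulrC.
  by apply: key => //; [rewrite adj_sym | rewrite eq_sym].
rewrite !sum_choice_prob_avoids// (negPf vu) (negPf vu') !mulr1 -!choice_prob_true.
(* Pushing to [u] and pushing to [u'] exclude each other, and 1 - x - y <= (1 - x)(1 - y). *)
have -> : \sum_c choice_prob q G v c * ((avoids pull u v c)%:R * (avoids pull u' v c)%:R) =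
    1 - choice_prob q G v (u, true) - choice_prob q G v (u', true).
  rewrite -[X in _ = X - _ - _](sum_choice_prob q G v).
  rewrite (bigD1 (u, true))//= /avoids eqxx mul0r mulr0 add0r.
  rewrite [in RHS](bigD1 (u, true))//= [X in _ = X - _]addrAC subrr add0r.
  have u'u : (u', true) != (u, true) by rewrite xpair_eqE eq_sym (negPf uu').
  rewrite (bigD1 (u', true))//= eqxx !mulr0 add0r.
  rewrite [in RHS](bigD1 (u', true))//= addrAC subrr add0r.
  apply: eq_bigr => c /andP[-> ->].
  by rewrite (negPf vu) (negPf vu') !andbF !mulr1.
have := choice_prob_ge0 G v (u, true) q0 q1.
have := choice_prob_ge0 G v (u', true) q0 q1.
move: (choice_prob _ _ _ _) (choice_prob _ _ _ _) => x y x0 y0.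
by have := mulr_ge0 x0 y0; nra.
Qed.

(** * Second moment bound for the uninformed part of U *)

Lemma sumr_nat_card (R : realType) n (K : {set 'I_n}) (b : pred 'I_n) :
  \sum_(u in K) (b u)%:R = #|[set u in K | b u]|%:R :> R.
Proof.
rewrite -natr_sum -sum1_card; congr (_%:R).
rewrite big_mkcond [RHS]big_mkcond; apply: eq_bigr => u _.
by rewrite inE; case: (u \in K); case: (b u).
Qed.

(* Second moment bound: the right-hand side is [E (1 - a X)^2] for a sum [X] of
   [#|K|] pairwise independent indicators of mean [p ^+ t]. *)
Lemma step_mean_setT (R : realType) (q : R) (pull : bool) n (G : graph n)
    (U : {set 'I_n}) (p a : R) t (S K : {set 'I_n}) :
  0 <= q -> q <= 1 ->
  {in U, forall u, deg G u != 0%N} ->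
  {in U &, forall u u', ~~ adj G u u'} ->
  {in U, forall u, escape_prob q pull G u = p} ->
  K \subset U -> [disjoint K & S] ->
  step_mean (rumour pull) q G t (fun S => (S == [set: 'I_n])%:R) S <=
  1 - (2 * a - a ^+ 2) * p ^+ t * #|K|%:R +
  a ^+ 2 * (p ^+ t) ^+ 2 * (#|K|%:R ^+ 2 - #|K|%:R).
Proof.
move=> q0 q1 degU indU pU; elim: t S K => [|t IH] S K KU KS /=.
  (* At time 0 the bound is (1 - a k)^2 with k = [#|K|], and k = 0 if everyone is informed. *)
  rewrite expr0 expr1n !mulr1; have [ST|_] := eqVneq S.
    have -> : K = finset.set0.
      by apply/eqP; rewrite -finset.subset0; apply/fintype.subsetP => x xK;
         move: (disjointFr KS xK); rewrite ST inE.
    by rewrite cards0 mulr0 expr0n subrr mulr0 subr0 addr0.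
  move: (#|K|%:R : R) => k; have := sqr_ge0 (1 - a * k).
  rewrite (_ : (1 - a * k) ^+ 2 =
    1 - (2 * a - a ^+ 2) * k + a ^+ 2 * (k ^+ 2 - k))//; ring.
(* The vertices of [K] that escape the first round are disjoint from the new informed set; the
   induction hypothesis applies to them. *)
pose Kf f := [set u in K | escapes pull f u].
set P := p ^+ t in IH *.
pose X f : R := \sum_(u in K) (escapes pull f u)%:R.
apply: (@le_trans _ _ (round_mean q G (fun f =>
    1 + ((- (2 * a - a ^+ 2) * P - a ^+ 2 * P ^+ 2) * X f + a ^+ 2 * P ^+ 2 * (X f * X f))))).
  apply: ler_round_mean => // f.
  apply: le_trans (IH (rumour pull S f) (Kf f) _ _) _.
  - by apply: fintype.subset_trans KU; apply/fintype.subsetP => u; rewrite inE => /andP[].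
  - rewrite disjoint_subset; apply/fintype.subsetP => u; rewrite inE => /andP[uK].
    by rewrite inE; apply: escapesP; rewrite (disjointFr KS uK).
  - by rewrite /X sumr_nat_card -/(Kf f); nra.
rewrite round_meanD round_mean_cst round_meanD !round_meanZ.
have -> : round_mean q G X = p * #|K|%:R.
  rewrite round_mean_sum mulr_natr -sumr_const; apply: eq_bigr => u uK.
  by rewrite mean_escapes ?pU ?degU// (fintype.subsetP KU).
(* Negative correlation bounds each mixed term by p^2. *)
have X2 : round_mean q G (fun f => X f * X f) <=
    p * #|K|%:R + p ^+ 2 * (#|K|%:R ^+ 2 - #|K|%:R).
  have -> : round_mean q G (fun f => X f * X f) =
      \sum_(u in K) \sum_(u' in K) round_mean q G (fun f =>
        (escapes pull f u)%:R * (escapes pull f u')%:R).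
    transitivity (round_mean q G (fun f => \sum_(u in K) \sum_(u' in K)
        (escapes pull f u)%:R * (escapes pull f u')%:R)).
      by apply: eq_bigr => f _; rewrite /X big_distrlr.
    by rewrite round_mean_sum; apply: eq_bigr => u _; rewrite round_mean_sum.
  have -> : p * #|K|%:R + p ^+ 2 * (#|K|%:R ^+ 2 - #|K|%:R) =
      \sum_(u in K) \sum_(u' in K) (if u' == u then p else p ^+ 2).
    under eq_bigr => u uK.
      rewrite (bigD1 u)//= eqxx.
      under eq_bigr => v /andP[_ /negPf ->] do over.
      rewrite (_ : \sum_(v in K | v != u) p ^+ 2 = p ^+ 2 * (#|K|%:R - 1)); first over.
      rewrite sumr_const -[LHS]mulr_natr; congr (_ * _).
      rewrite (cardsD1 u K) uK natrD addrAC subrr add0r; congr (_%:R).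
      by apply: eq_card => v; rewrite !inE andbC.
    rewrite sumr_const -[RHS]mulr_natr; ring.
  apply: ler_sum => u uK; apply: ler_sum => u' u'K.
  have uU := fintype.subsetP KU _ uK; have u'U := fintype.subsetP KU _ u'K.
  have [->|nuu'] := eqVneq u' u.
    rewrite -[leRHS](pU u uU) -mean_escapes ?degU//.
    by apply: ler_round_mean => // f; case: escapes; rewrite ?mulr1 ?mulr0.
  rewrite expr2 -{1}(pU u uU) -(pU u' u'U); apply: mean_escapes2; rewrite ?degU//.
    by rewrite eq_sym.
  exact: indU.
(* The mean of [X] is known exactly, so only the coefficient of X^2 needs a sign. *)
have a2P2 : 0 <= a ^+ 2 * P ^+ 2 by rewrite mulr_ge0 ?sqr_ge0.
have := ler_wpM2l a2P2 X2; rewrite (exprS p t) -/P -(lerD2l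
  (1 + (- (2 * a - a ^+ 2) * P - a ^+ 2 * P ^+ 2) * (p * #|K|%:R))) -addrA.
move=> /le_trans; apply; rewrite le_eqVlt; apply/orP; left; apply/eqP; ring.
Qed.

(** If [S] has at least half the size of [U], the first summand is at least 1. Otherwise at least
    half of [U] is uninformed and the second moment bound applies to [U :\: S]. Linearity in [#|S|]
    allows averaging over the early phase. *)
Lemma step_mean_setT_le (R : realType) (q : R) (pull : bool) n (G : graph n)
    (U : {set 'I_n}) (p : R) t (S : {set 'I_n}) :
  0 <= q -> q <= 1 ->
  {in U, forall u, deg G u != 0%N} ->
  {in U &, forall u u', ~~ adj G u u'} ->
  {in U, forall u, escape_prob q pull G u = p} ->
  (0 < #|U|)%N -> 0 < p ->
  step_mean (rumour pull) q G t (fun S => (S == [set: 'I_n])%:R) S <=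
  2 / #|U|%:R * #|S|%:R + 2 / (#|U|%:R * p ^+ t).
Proof.
move=> q0 q1 degU indU pU U0 p0.
have u0 : 0 < #|U|%:R :> R by rewrite ltr0n.
have Pt0 : 0 < p ^+ t by rewrite exprn_gt0.
have [SU|SU] := leP (#|U|%:R : R) (2 * #|S|%:R).
  apply: (@le_trans _ _ 1).
    elim: (t) S {SU} => [|s IH] S /=; first by case: eqP.
    by rewrite -[leRHS](round_mean_cst q G 1); apply: ler_round_mean.
  apply: (@le_trans _ _ (2 / #|U|%:R * #|S|%:R)).
    by rewrite mulrAC ler_pdivlMr// mul1r.
  by rewrite lerDl divr_ge0// mulr_ge0 ?ler0n ?(ltW Pt0).
set k : R := #|U :\: S|%:R.
have kU : #|U|%:R <= 2 * k.
  have : (#|U| <= #|U :\: S| + #|S|)%N.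
    rewrite -(cardsID S U) addnC leq_add2l.
    by rewrite subset_leq_card// finset.subsetIr.
  rewrite -(ler_nat R) natrD -/k; lra.
have k0 : 0 < k by lra.
set x := p ^+ t * k; have x0 : 0 < x by rewrite mulr_gt0.
(* The value a = 1 / (1 + x) minimises 1 - 2 a x + a^2 (x + x^2), an upper bound for the second
   moment expression, with minimum 1 / (1 + x). *)
have := @step_mean_setT R q pull n G U p (1 + x)^-1 t S (U :\: S) q0 q1 degU indU pU.
move=> /(_ (finset.subsetDl _ _)) /(_ _) /le_trans; apply.
  rewrite disjoint_subset; apply/fintype.subsetP => u.
  by rewrite !inE => /andP[].
rewrite -/k; apply: (@le_trans _ _ ((1 + x)^-1)).
  rewrite -subr_ge0.
  have -> : (1 + x)^-1 - (1 - (2 * (1 + x)^-1 - (1 + x)^-1 ^+ 2) * p ^+ t * k +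
     (1 + x)^-1 ^+ 2 * p ^+ t ^+ 2 * (k ^+ 2 - k)) =
     (1 + x)^-1 ^+ 2 * p ^+ t ^+ 2 * k.
    by rewrite /x; field; rewrite -/x; apply: lt0r_neq0; lra.
  by rewrite mulr_ge0 ?(ltW k0)// mulr_ge0 ?sqr_ge0.
apply: (@le_trans _ _ (2 / (#|U|%:R * p ^+ t))).
  rewrite ler_pdivlMr ?mulr_gt0// ler_pdivrMl; last by lra.
  have := ler_wpM2l (ltW Pt0) kU; rewrite /x; nra.
by rewrite lerDr mulr_ge0 ?divr_ge0.
Qed.

(** The process is split at time [t1]: the mean of [#|S|] controls the early phase, the second
    moment bound the late one. *)
Lemma law_setT_le (R : realType) (q : R) (pull : bool) n (G : graph n)
    (U : {set 'I_n}) v0 (p g : R) t1 t2 :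
  0 <= q -> q <= 1 -> 0 <= 1 + g ->
  (forall v, q * (deg G v != 0%N)%:R +
     pull%:R * (q * \sum_w (adj G w v)%:R / (deg G w)%:R) <= g) ->
  {in U, forall u, deg G u != 0%N} ->
  {in U &, forall u u', ~~ adj G u u'} ->
  {in U, forall u, escape_prob q pull G u = p} ->
  (0 < #|U|)%N -> 0 < p ->
  law (rumour pull) q G v0 (t1 + t2) [set: 'I_n] <=
  2 / #|U|%:R * ((1 + g) ^+ t1 + (p ^+ t2)^-1).
Proof.
move=> q0 q1 g0 gP degU indU pU U0 p0; rewrite law_setT law_mean_step.
apply: (@le_trans _ _ (law_mean (rumour pull) q G v0 t1 (fun S =>
    2 / #|U|%:R * #|S|%:R + 2 / (#|U|%:R * p ^+ t2)))).
  by apply: ler_law_mean => // S; exact: step_mean_setT_le.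
rewrite law_meanD law_meanZ law_mean_cst mulrDr invfM mulrA lerD2r.
by rewrite ler_wpM2l ?divr_ge0//; exact: law_mean_card.
Qed.

(** Markov's inequality for the number of informed vertices. *)
Lemma law_setT_le_card (R : realType) (q : R) (pull : bool) n (G : graph n) v0 (g : R) t :
  0 <= q -> q <= 1 -> 0 <= 1 + g ->
  (forall v, q * (deg G v != 0%N)%:R +
     pull%:R * (q * \sum_w (adj G w v)%:R / (deg G w)%:R) <= g) ->
  law (rumour pull) q G v0 t [set: 'I_n] <= (1 + g) ^+ t / n%:R.
Proof.
move=> q0 q1 g0 gP; have n0 : 0 < n%:R :> R by rewrite ltr0n (leq_ltn_trans _ (ltn_ord v0)).
rewrite ler_pdivlMr// mulrC law_setT -law_meanZ.
apply: (@le_trans _ _ (law_mean (rumour pull) q G v0 t (fun S => #|S|%:R))); last first.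
  exact: law_mean_card.
apply: ler_law_mean => // S.
have [->|_] := eqVneq S; first by rewrite cardsT card_ord mulr1.
by rewrite mulr0.
Qed.

(** * The complete graph is an expander *)

Definition complete_graph n : graph n :=
  @Graph n (fun i j => i != j) (fun i j => congr1 negb (eq_sym i j)) (fun i => negbF (eqxx i)).

Lemma deg_complete n (v : 'I_n) : deg (complete_graph n) v = n.-1.
Proof.
rewrite /deg (_ : [set u | _] = [set~ v]) ?cardsC1 ?card_ord//.
by apply/setP => u; rewrite !inE eq_sym.
Qed.

Lemma maxdeg_complete n : maxdeg (complete_graph n) = n.-1.
Proof.
rewrite /maxdeg; case: n => [|n]; first by rewrite big_ord0.
apply/eqP; rewrite eqn_leq; apply/andP; split.
  by apply/bigmax_leqP => v _; rewrite deg_complete.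
by apply: leq_trans (leq_bigmax ord0); rewrite deg_complete.
Qed.

Lemma mindeg_complete n : (0 < n)%N -> mindeg (complete_graph n) = n.-1.
Proof.
case: n => // n _; rewrite /mindeg; under eq_bigr do rewrite deg_complete.
have H k : iter k.+1 (minn n) n.+1 = n.
  elim: k => [|k IH]; first by apply/minn_idPl; exact: leqnSn.
  by rewrite iterS IH minnn.
by rewrite big_const_ord H.
Qed.

(* The matrix determinant lemma for [a I - u v], without dividing by [a]. *)
Lemma det_scalar_sub_rank1 (K : comRingType) n (a : K) (u : 'cV[K]_n) (v : 'rV[K]_n) :
  a * \det (a%:M - u *m v) = a ^+ n * (a - (v *m u) 0 0).
Proof.
(* Two eliminations in one bordered matrix: clearing [u] leaves a I - u v; clearing [v], after
   scaling the last row by [a], leaves a - v u. *)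
pose M := block_mx a%:M u v (1%:M : 'M[K]_1).
have detM : \det M = \det (a%:M - u *m v).
  have -> : M = block_mx 1%:M u 0 1%:M *m block_mx (a%:M - u *m v) 0 v 1%:M.
    by rewrite mulmx_block !mul1mx !mul0mx !mulmx1 add0r subrK !add0r.
  by rewrite det_mulmx det_ublock det_lblock !det1 !mul1r mulr1.
have : block_mx 1%:M 0 (- v) (a%:M : 'M[K]_1) *m M =
    block_mx a%:M u 0 (a%:M - v *m u).
  rewrite mulmx_block !mul1mx !mul0mx !addr0 mulmx1; congr block_mx.
    by rewrite mulNmx mul_mx_scalar mul_scalar_mx addrC subrr.
  by rewrite mulNmx addrC.
move=> /(congr1 determinant); rewrite det_mulmx det_lblock det1 mul1r det_ublock.
by rewrite detM !det_scalar !det_mx11 !mxE eqxx expr1 /= mulr1n => ->.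
Qed.

(** The matrix X I - A is (X + 1) I - J, where the all-ones matrix J has rank one; the extra factor
    X + 1 of the determinant lemma cancels. *)
Lemma char_poly_complete (R : realType) n :
  char_poly (adjmx R (complete_graph n.+1)) =
  \prod_(x <- n%:R :: nseq n (-1)) ('X - x%:P).
Proof.
have a0 : 'X + 1 != 0 :> {poly R}.
  by rewrite -[1]opprK -[1]/(1%:P) -polyCN polyXsubC_eq0.
apply: (mulfI a0).
have -> : char_poly (adjmx R (complete_graph n.+1)) =
    \det (('X + 1)%:M - (const_mx 1 : 'cV[{poly R}]_n.+1) *m (const_mx 1 : 'rV[{poly R}]_n.+1)).
  congr (\det _); apply/matrixP => i j; rewrite !mxE big_ord_recl big_ord0 !mxE /=.
  by case: eqVneq => _ /=; rewrite ?mulr1n ?mulr0n /= ?polyC0 ?polyC1; ring.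
rewrite det_scalar_sub_rank1 big_cons big_nseq -Monoid.iteropE /=.
rewrite (_ : ('X - (-1)%:P) = 'X + 1); last by rewrite polyCN opprK.
rewrite exprS -mulrA; congr (_ * _); rewrite mulrC; congr (_ * _).
rewrite mxE; under eq_bigr do rewrite !mxE mulr1.
rewrite sumr_const card_ord polyC_natr -natr1; ring.
Qed.

(** For n <= 1 there is no second eigenvalue and the list access returns the default 0, whence the
    case distinction. *)
Lemma second_eig_complete (R : realType) n :
  second_eig (complete_graph n) (if (n <= 1)%N then 0 else 1 : R).
Proof.
case: n => [|n].
  exists [::]; split; first split=> //; last by rewrite /= normr0 maxxx.
  by rewrite big_nil /char_poly det_mx00.
exists (n%:R :: nseq n (-1)); split; first split.
- rewrite /= path_sortedE; last by move=> y x z /= xy yz; exact: le_trans yz xy.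
  rewrite all_nseq /= (le_trans (lerN10 R) (ler0n R n)) orbT /=.
  by elim: n => //= -[|n] //= ->; rewrite lexx.
- exact: char_poly_complete.
case: n => [|n] /=; first by rewrite normr0 maxxx.
by rewrite -[_`_n]/((nseq n.+1 (-1))`_n) nth_nseq leqnn normrN1 maxxx.
Qed.

Lemma complete_expander (R : realType) : expander_seq R complete_graph.
Proof.
split; last split.
- move=> n x y; have [->|xy] := eqVneq x y; first exact: connect0.
  exact: connect1.
- apply: cvg_near_cst; exists 2%N => // n /= n2.
  rewrite maxdeg_complete mindeg_complete ?(ltnW n2)// divff// pnatr_eq0.
  by case: n n2 => [|[]].
exists (fun n => if (n <= 1)%N then 0 else 1); split.
  by move=> n; exact: second_eig_complete.
(* Shifted by two, the quotient is 1 / (n + 1). *)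
rewrite -cvg_shiftS -cvg_shiftS /=.
under eq_fun do rewrite maxdeg_complete /= div1r.
exact: cvg_harmonic.
Qed.

(** * The pruned graph *)

Lemma pruned_adj_sym n (k m : nat) : symmetric (fun i j : 'I_n =>
  (i != j) && ~~ ((i < k) && (j < m) || (j < k) && (i < m))%N).
Proof. by move=> i j; rewrite eq_sym orbC. Qed.

Lemma pruned_adj_irr n (k m : nat) : irreflexive (fun i j : 'I_n =>
  (i != j) && ~~ ((i < k) && (j < m) || (j < k) && (i < m))%N).
Proof. by move=> i; rewrite eqxx. Qed.

(** Here U is the set of indices below [k] and M the set of those below [m]. *)
Definition pruned_graph n (k m : nat) : graph n :=
  Graph (@pruned_adj_sym n k m) (@pruned_adj_irr n k m).

Lemma card_ord_lt n k : (k <= n)%N -> #|[set i : 'I_n | (i < k)%N]| = k.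
Proof.
move=> kn; rewrite -sum1_card (eq_bigl (fun i : 'I_n => (i < k)%N)).
  by rewrite (big_ord_narrow kn) sum1_card card_ord.
by move=> i; rewrite inE.
Qed.

Lemma card_ord_ge n k : (k <= n)%N -> #|[set i : 'I_n | (k <= i)%N]| = (n - k)%N.
Proof.
move=> kn; rewrite cardsCs card_ord -[in RHS](card_ord_lt kn); congr (n - _)%N.
by apply: eq_card => i; rewrite !inE -ltnNge.
Qed.

Lemma deg_pruned_low n k m (v : 'I_n) : (k <= m)%N -> (m <= n)%N -> (v < k)%N ->
  deg (pruned_graph n k m) v = (n - m)%N.
Proof.
move=> km mn vk; rewrite -(card_ord_ge mn); apply: eq_card => u.
rewrite !inE /= vk (leq_trans vk km) andbT /=.
rewrite negb_or -!leqNgt; apply/idP/idP => [/andP[_ /andP[]]//|mu].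
by rewrite mu (leq_trans km mu) neq_ltn (leq_trans vk (leq_trans km mu)).
Qed.

Lemma deg_pruned_high n k m (v : 'I_n) : (k <= m)%N -> (m <= v)%N ->
  deg (pruned_graph n k m) v = n.-1.
Proof.
move=> km mv; rewrite -(deg_complete v); apply: eq_card => u.
rewrite !inE /= [(v < m)%N]ltnNge mv [(v < k)%N]ltnNge (leq_trans km mv).
by rewrite /= andbF andbT.
Qed.

Lemma deg_pruned_ge n k m (v : 'I_n) : (k <= n)%N -> (k <= v)%N ->
  (n - k.+1 <= deg (pruned_graph n k m) v)%N.
Proof.
move=> kn kv; rewrite leq_subLR -[X in (X <= _)%N]card_ord -cardsT.
apply: (@leq_trans #|(v |: [set i : 'I_n | (i < k)%N]) :|:
                     [set u | adj (pruned_graph n k m) v u]|).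
  apply/subset_leq_card/fintype.subsetP => u _; rewrite !inE /= [(v < k)%N]ltnNge kv /=.
  by case: eqVneq => //= _; case: ltnP.
apply: leq_trans (leq_card_setU _ _) _; rewrite leq_add2r.
apply: leq_trans (leq_card_setU _ _) _.
by rewrite cards1 card_ord_lt.
Qed.

Lemma pruned_keeps_fraction (R : realType) (eps : R) n k m :
  0 <= eps -> eps <= 1 -> (k <= m)%N -> (m <= n)%N -> m%:R <= eps * n%:R ->
  keeps_fraction eps (complete_graph n) (pruned_graph n k m).
Proof.
move=> e0 e1 km mn mE; split=> [u v /andP[]//|v].
rewrite deg_complete; have n0 := leq_ltn_trans (leq0n v) (ltn_ord v).
have -> : n.-1%:R = n%:R - 1 :> R by rewrite -subn1 natrB.
have [vk|kv] := ltnP v k.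
  rewrite deg_pruned_low// natrB//; nra.
have [vm|mv] := ltnP v m.
  apply: (@le_trans _ _ (n - k.+1)%:R); last by rewrite ler_nat deg_pruned_ge// (leq_trans km mn).
  (* This vertex lies in M but not in U, so k + 1 <= m: the [k] lost neighbours and the vertex
     itself fit into eps n. *)
  have km' : (k.+1 <= m)%N by apply: leq_ltn_trans kv vm.
  have kE : k.+1%:R <= eps * n%:R by apply: le_trans mE; rewrite ler_nat.
  rewrite natrB; last by apply: leq_trans mn.
  move: kE; rewrite -!natr1; nra.
rewrite deg_pruned_high// -subn1 natrB//.
have : 1 <= n%:R :> R by rewrite ler1n.
nra.
Qed.

(** Only the n - m vertices outside M are adjacent to [u], and their degree is n - 1. The value is
    the same on all of U, as the second moment bound requires. *)
Lemma escape_prob_pruned (R : realType) (q : R) (pull : bool) n k m (u : 'I_n) :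
  (k <= m)%N -> (m <= n)%N -> (u < k)%N ->
  escape_prob q pull (pruned_graph n k m) u =
  (1 - q / n.-1%:R) ^+ (n - m) * (1 - pull%:R * q).
Proof.
move=> km mn uk; rewrite /escape_prob; congr (_ * _).
rewrite -(card_ord_ge mn) -prodr_const [RHS]big_mkcond /=; apply: eq_bigr => v _.
rewrite inE /= uk; have [mv|vm] := leqP m v.
  rewrite deg_pruned_high// [(v < k)%N]ltnNge (leq_trans km mv) /=.
  by rewrite neq_ltn (leq_trans uk (leq_trans km mv)) orbT mul1r.
by rewrite orbT andbF mul0r mulr0 subr0.
Qed.

(** The [k] callers in U have degree n - m, all others have degree at least n - k - 1. *)
Lemma pruned_pull_sum (R : realType) n k m (v : 'I_n) :
  (k <= m)%N -> (m < n)%N -> (k.+1 < n)%N ->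
  \sum_w (adj (pruned_graph n k m) w v)%:R / (deg (pruned_graph n k m) w)%:R <=
  k%:R / (n - m)%:R + n%:R / (n - k.+1)%:R :> R.
Proof.
move=> km mn kn; have kn' : (k <= n)%N by rewrite (leq_trans km)// ltnW.
pose F (w : 'I_n) : R := (w < k)%N%:R / (n - m)%:R + 1 / (n - k.+1)%:R.
apply: (@le_trans _ _ (\sum_w F w)).
  apply: ler_sum => w _; rewrite /F.
  have [wk|kw] := ltnP w k.
    rewrite deg_pruned_low// ?(ltnW mn)//.
    apply: (@le_trans _ _ (1 / (n - m)%:R)); last by rewrite lerDl divr_ge0.
    by rewrite ler_wpM2r ?invr_ge0// lern1 leq_b1.
  rewrite mul0r add0r; apply: ler_pM; rewrite ?invr_ge0//.
    by rewrite lern1 leq_b1.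
  rewrite lef_pV2 ?posrE ?ltr0n ?subn_gt0//; last first.
    by apply: leq_trans (deg_pruned_ge m kn' kw); rewrite subn_gt0.
  by rewrite ler_nat deg_pruned_ge.
rewrite big_split /= -mulr_suml -natr_sum sumr_const card_ord -mulrnAl.
rewrite (_ : (\sum_(i < n) (i < k))%N = k)// -[RHS](card_ord_lt kn') -sum1_card.
by rewrite [RHS]big_mkcond; apply: eq_bigr => i _; rewrite inE; case: ltnP.
Qed.

Lemma law_pruned_le (R : realType) (q : R) (pull : bool) n k m v0 g t1 t2 :
  0 <= q -> q <= 1 -> (pull -> q < 1) ->
  (k <= m)%N -> (m < n)%N -> (k.+1 < n)%N -> (0 < k)%N -> (2 < n)%N ->
  q + pull%:R * (q * (k%:R / (n - m)%:R + n%:R / (n - k.+1)%:R)) <= g ->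
  law (rumour pull) q (pruned_graph n k m) v0 (t1 + t2) [set: 'I_n] <=
  2 / k%:R * ((1 + g) ^+ t1 +
    (((1 - q / n.-1%:R) ^+ (n - m) * (1 - pull%:R * q)) ^+ t2)^-1).
Proof.
move=> q0 q1 pq km mn kn k0 n2 gP.
have sum0 : 0 <= q * (k%:R / (n - m)%:R + n%:R / (n - k.+1)%:R).
  by rewrite mulr_ge0// addr_ge0// divr_ge0.
have cardU : #|[set u : 'I_n | (u < k)%N]| = k.
  by rewrite card_ord_lt// (leq_trans km)// ltnW.
rewrite -[in leRHS]cardU; apply: law_setT_le => //.
- by rewrite (le_trans _ (lerD (lexx 1) gP))// addr_ge0// addr_ge0// mulr_ge0.
- move=> v; apply: le_trans gP; apply: lerD.
    by rewrite ler_piMr// lern1 leq_b1.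
  by rewrite ler_wpM2l// ler_wpM2l// pruned_pull_sum.
- by move=> u; rewrite inE => uk; rewrite deg_pruned_low ?(ltnW mn)// subn_eq0 -ltnNge.
- move=> u u'; rewrite !inE => uk u'k /=.
  by rewrite uk (leq_trans u'k km) /= andbF.
- by move=> u; rewrite inE => uk; rewrite escape_prob_pruned// ltnW.
- by rewrite cardU.
(* As n - 1 > 1 >= q, the base of the power is positive; under pull, q < 1 keeps the last factor
   positive. *)
- have n1 : (1 < n.-1)%N by case: (n) n2 => [|[]].
  have n1R : 1 < n.-1%:R :> R by rewrite ltr1n.
  apply: mulr_gt0.
    apply: exprn_gt0; rewrite subr_gt0 ltr_pdivrMr ?(lt_trans ltr01)//.
    by rewrite mul1r (le_lt_trans q1).
  by case: pull pq {gP} => [/(_ isT)|_]; rewrite ?mul1r ?mul0r ?subr_gt0 ?subr0.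
Qed.

(** * Asymptotics *)

Lemma near_nat_ge (R : realType) (M : R) : (\forall n \near \oo, M <= n%:R)%classic.
Proof.
exists (Num.truncn M).+1 => // n /= Mn; apply/ltW.
by apply: lt_le_trans (truncnS_gt M) _; rewrite ler_nat.
Qed.

Lemma near_ln_ge (R : realType) (M : R) : (\forall n \near \oo, M <= ln (n%:R : R))%classic.
Proof.
apply: filterS (near_nat_ge (expR M)) => n Mn.
by rewrite -[M]expRK ler_ln ?posrE ?expR_gt0// (lt_le_trans (expR_gt0 M)).
Qed.

(** Growth by exp E over a log n rounds gives n^(a E), which is o(n) because a E < 1. *)
Lemma near_expR_truncn (R : realType) (E a e : R) :
  0 <= E -> 0 <= a -> a * E < 1 -> 0 < e ->
  (\forall n \near \oo, expR E ^+ Num.truncn (a * ln (n%:R : R)) / n%:R <= e)%classic.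
Proof.
move=> E0 a0 aE e0.
near=> n.
have ln0 : 0 <= ln (n%:R : R) by near: n; exact: near_ln_ge.
have n0 : 0 < n%:R :> R.
  by rewrite (@lt_le_trans _ _ 1)//; near: n; exact: near_nat_ge.
have al0 : 0 <= a * ln (n%:R : R) by rewrite mulr_ge0.
have /andP[tle _] := truncn_itv al0.
rewrite -expRM_natl.
apply: (@le_trans _ _ (expR ((a * E - 1) * ln (n%:R : R)))).
  rewrite mulrBl mul1r expRB lnK ?posrE// ler_pM2r ?invr_gt0// ler_expR.
  by nra.
rewrite -[leRHS]lnK ?posrE// ler_expR -lerN2 -mulNr opprB.
rewrite mulrC -ler_pdivrMr ?subr_gt0//.
by near: n; exact: near_ln_ge.
Unshelve. all: by end_near.
Qed.

(** Rounding both durations down loses less than two rounds: h = 1 covers one, and an unfinished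
    process at time t has T >= t + 1, which covers the other. *)
Lemma whp_lowerP (R : realType) P (q : R) (G : forall n, graph n) a b c d :
  0 <= q -> q <= 1 -> increasing P -> 0 <= a -> 0 <= b -> c + d <= a + b ->
  (forall e : R, 0 < e -> (\forall n \near \oo, forall v0 : 'I_n,
    law P q (G n) v0 (Num.truncn (a * ln (n%:R : R)) + Num.truncn (b * ln (n%:R : R)))
      [set: 'I_n] <= e)%classic) ->
  whp_lower P q G (fun n => c * ln (n%:R) + d * ln (n%:R)).
Proof.
move=> q0 q1 incP a0 b0 cd small; exists (fun=> 1); split=> //; split.
  apply/cvgr0Pnorm_le => e e0; near=> n.
  have e1 : e^-1 <= ln (n%:R : R) by near: n; exact: near_ln_ge.
  have l0 : 0 < ln (n%:R : R) by apply: lt_le_trans e1; rewrite invr_gt0.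
  by rewrite ger0_norm ?divr_ge0 ?(ltW l0)// div1r -[e]invrK lef_pV2 ?posrE ?invr_gt0.
move=> e e0; near=> n => v0.
apply: (@le_trans _ _ (1 - law P q (G n) v0
  (Num.truncn (a * ln (n%:R : R)) + Num.truncn (b * ln (n%:R : R))) [set: 'I_n])).
  by rewrite lerB//; move: v0; near: n; exact: small.
apply: prob_T_ge_lower => //.
have ln0 : 0 <= ln (n%:R : R) by near: n; exact: near_ln_ge.
have := truncnS_gt (a * ln (n%:R : R)); have := truncnS_gt (b * ln (n%:R : R)).
have := ler_wpM2r ln0 cd.
rewrite -!natr1 natrD; nra.
Unshelve. all: by end_near.
Qed.

Lemma near_pruned_sizes (R : realType) (eps delta : R) :
  0 < eps -> eps < 1 -> 0 < delta -> delta <= 1 / 4 -> delta <= eps ->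
  (\forall n \near \oo,
    let k := Num.truncn (delta * n%:R) in let m := Num.truncn (eps * n%:R) in
    [/\ (k <= m)%N, (m < n)%N, (k.+1 < n)%N, (0 < k)%N & (2 < n)%N] /\
    k%:R^-1 <= 2 / (delta * n%:R) /\
    k%:R / (n - m)%:R + n%:R / (n - k.+1)%:R <=
      1 + (4 + (1 - eps)^-1) * delta)%classic.
Proof.
move=> e0 e1 d0 d14 de; near=> n.
have n3 : 3 <= n%:R :> R by near: n; exact: near_nat_ge.
(* Ensures that [k] is at least delta n / 2. *)
have dn : 2 <= delta * n%:R.
  rewrite [leRHS]mulrC -ler_pdivrMr//; near: n; exact: near_nat_ge.
set k := Num.truncn (delta * n%:R); set m := Num.truncn (eps * n%:R); cbv zeta.
have dn0 : 0 <= delta * n%:R by lra.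
have en0 : 0 <= eps * n%:R by nra.
have /andP[k1 k2] := truncn_itv dn0; have /andP[m1 m2] := truncn_itv en0.
rewrite -/k -natr1 in k1 k2; rewrite -/m -natr1 in m1 m2.
have mn : (m < n)%N by rewrite -(ltr_nat R); nra.
have kn : (k.+1 < n)%N by rewrite -(ltr_nat R) -natr1; nra.
have k0 : 0 < k%:R :> R by lra.
split; first split=> //.
- by apply: le_truncn; nra.
- by rewrite -(ltr_nat R).
- by rewrite -(ltr_nat R); lra.
split.
  rewrite -[leRHS]invrK lef_pV2 ?posrE ?invr_gt0 ?divr_gt0//; last by lra.
  by rewrite invfM invrK; nra.
rewrite !natrB 1?ltnW// -natr1 mulrDl addrC addrA addrAC.
(* The constant 4 leaves room for the 1 in k + 1 <= delta n + 1, given delta <= 1/4 and delta n >=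
   2. *)
have nk : n%:R / (n%:R - (k%:R + 1)) <= 1 + 4 * delta :> R.
  by rewrite ler_pdivrMr; nra.
have km : k%:R / (n%:R - m%:R) <= (1 - eps)^-1 * delta.
  rewrite ler_pdivrMr; last by rewrite subr_gt0 ltr_nat.
  rewrite -mulrA ler_pdivlMl ?subr_gt0//; nra.
lra.
Unshelve. all: by end_near.
Qed.

(** The inequality 1 + y <= exp y at y = q / (n - 1 - q) reads 1 - q / (n - 1) >= exp (- y). The
    exponent (n - m) y tends to q (1 - eps), and [s] absorbs the error. *)
Lemma near_expR_escape (R : realType) (q eps s : R) :
  0 < q -> q <= 1 -> 0 < eps -> eps < 1 -> 0 < s ->
  (\forall n \near \oo, expR (- (q * (1 - eps) + s)) <=
    (1 - q / n.-1%:R) ^+ (n - Num.truncn (eps * n%:R)))%classic.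
Proof.
move=> q0 q1 e0 e1 s0; near=> n.
have n3 : 3 <= n%:R :> R by near: n; exact: near_nat_ge.
(* The error terms amount to at most 3, and s (n - 1 - q) >= s n - 2 s. *)
have sn : 3 + 2 * s <= s * n%:R.
  rewrite [leRHS]mulrC -ler_pdivrMr//; near: n; exact: near_nat_ge.
set m := Num.truncn (eps * n%:R).
have en0 : 0 <= eps * n%:R by nra.
have /andP[m1 m2] := truncn_itv en0; rewrite -/m -natr1 in m1 m2.
have mn : (m <= n)%N by rewrite -(ler_nat R); nra.
have n0 : (0 < n)%N by rewrite -(ltr_nat R); lra.
have -> : n.-1%:R = n%:R - 1 :> R by rewrite -subn1 natrB.
set x := q / (n%:R - 1).
have nq : 0 < n%:R - 1 - q by lra.
have xE : 1 + q / (n%:R - 1 - q) = (1 - x)^-1.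
  rewrite /x; field.
  by apply/andP; split; apply: lt0r_neq0; lra.
have x1 : 0 < 1 - x.
  by rewrite -invr_gt0 -xE addr_gt0// divr_gt0.
apply: (@le_trans _ _ (expR (- (q / (n%:R - 1 - q))) ^+ (n - m))).
  rewrite -expRM_natl ler_expR mulrN lerN2 mulrA ler_pdivrMr// natrB//.
  have : n%:R - m%:R <= n%:R * (1 - eps) + 1 by lra.
  move=> h; apply: (@le_trans _ _ ((n%:R * (1 - eps) + 1) * q)).
    by rewrite ler_pM2r.
  have : 0 <= q * (1 - eps) by nra.
  nra.
rewrite lerXn2r ?nnegrE ?expR_ge0 ?(ltW x1)//.
rewrite expRN -[leRHS]invrK lef_pV2 ?posrE ?expR_gt0 ?invr_gt0// -xE.
exact: expR_ge1Dx.
Unshelve. all: by end_near.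
Qed.

(* On [pruned_graph] one round multiplies the expected number of informed
   vertices by at most [1 + growth]. *)
Definition growth (R : realType) (q eps delta : R) (pull : bool) : R :=
  q + pull%:R * (q * (1 + (4 + (1 - eps)^-1) * delta)).

Lemma growth_ge0 (R : realType) (q eps delta : R) pull :
  0 < q -> eps < 1 -> 0 < delta -> 0 <= growth q eps delta pull.
Proof.
move=> q0 e1 d0; have i0 : 0 < (1 - eps)^-1 by rewrite invr_gt0 subr_gt0.
by rewrite addr_ge0 ?(ltW q0)// mulr_ge0// mulr_ge0 ?(ltW q0)//; nra.
Qed.

(** The phases last a log n and b log n rounds. The strict inequalities make the growth in the early
    phase and the inverse survival probability in the late phase o(n), hence small against the size
    of U, about delta n. *)
Lemma whp_pruned (R : realType) (q eps delta s a b c d : R) (pull : bool) :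
  0 < q -> q <= 1 -> (pull -> q < 1) -> 0 < eps -> eps < 1 ->
  0 < delta -> delta <= 1 / 4 -> delta <= eps -> 0 < s -> 0 <= a -> 0 <= b ->
  a * ln (1 + growth q eps delta pull) < 1 ->
  b * (q * (1 - eps) - ln (1 - pull%:R * q) + s) < 1 ->
  c + d <= a + b ->
  whp_lower (rumour pull) q (fun n =>
      pruned_graph n (Num.truncn (delta * n%:R)) (Num.truncn (eps * n%:R)))
    (fun n => c * ln (n%:R) + d * ln (n%:R)).
Proof.
move=> q0 q1 pq e0 e1 d0 d14 de s0 a0 b0 aG bD cd.
set g := growth _ _ _ _ in aG *; set D := _ + s in bD.
have g0 : 0 <= g by exact: growth_ge0.
have pq0 : 0 < 1 - pull%:R * q.
  by case: pull pq {aG bD g g0 D} => [/(_ isT)|_]; rewrite ?mul1r ?mul0r ?subr_gt0 ?subr0.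
have pq1 : 1 - pull%:R * q <= 1 by rewrite gerBl mulr_ge0// ltW.
have D0 : 0 <= D.
  have qe : 0 <= q * (1 - eps) by rewrite mulr_ge0 ?subr_ge0 ?(ltW q0) ?(ltW e1).
  by have := ln_le0 pq1; rewrite /D; lra.
apply: (whp_lowerP (ltW q0) q1 (@rumour_increasing pull) a0 b0 cd).
(* Two terms of this size, multiplied by 4 / delta from 2 / k <= 4 / (delta n), give [e]. *)
move=> e e'0; have e'd : 0 < e * delta / 8 by rewrite divr_gt0// mulr_gt0.
have := near_pruned_sizes e0 e1 d0 d14 de; apply: filter_app.
near=> n => -[[km mn kn k0 n2] [kinv sumk]] v0.
have n1 : 1 <= n%:R :> R by near: n; exact: near_nat_ge.
have n0 : 0 < n%:R :> R by lra.
set k := Num.truncn (delta * n%:R); set m := Num.truncn (eps * n%:R).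
apply: le_trans (law_pruned_le v0 _ _ (ltW q0) q1 pq km mn kn k0 n2 (_ : _ <= g)) _.
  by rewrite lerD2l ler_wpM2l// ler_wpM2l// ltW.
set t1 := Num.truncn (a * _); set t2 := Num.truncn (b * _).
have B1 : (1 + g) ^+ t1 / n%:R <= e * delta / 8.
  rewrite -[1 + g]lnK ?posrE//; last by lra.
  by rewrite /t1; near: n; apply: near_expR_truncn => //; apply: ln_ge0; lra.
have B2 : expR D ^+ t2 / n%:R <= e * delta / 8.
  by rewrite /t2; near: n; apply: near_expR_truncn.
have B3 : (((1 - q / n.-1%:R) ^+ (n - m) * (1 - pull%:R * q)) ^+ t2)^-1 <= expR D ^+ t2.
  have pD : expR (- D) <= (1 - q / n.-1%:R) ^+ (n - m) * (1 - pull%:R * q).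
    rewrite (_ : - D = - (q * (1 - eps) + s) + ln (1 - pull%:R * q)); last by rewrite /D; ring.
    rewrite expRD [in leLHS]lnK ?posrE// ler_pM2r//.
    by rewrite /m; near: n; apply: near_expR_escape.
  have p0 := lt_le_trans (expR_gt0 _) pD.
  rewrite -[leRHS]invrK lef_pV2 ?posrE ?invr_gt0 ?exprn_gt0 ?expR_gt0//.
  by rewrite -exprVn -expRN lerXn2r ?nnegrE ?expR_ge0 ?(ltW p0).
apply: (@le_trans _ _ (2 / k%:R * ((1 + g) ^+ t1 + expR D ^+ t2))).
  by rewrite ler_wpM2l ?divr_ge0// lerD2l.
apply: (@le_trans _ _ (2 * (2 / (delta * n%:R)) * ((1 + g) ^+ t1 + expR D ^+ t2))).
  apply: ler_wpM2r; last by rewrite ler_pM2l.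
  by apply: addr_ge0; apply: exprn_ge0; [exact: addr_ge0|exact: expR_ge0].
rewrite (_ : _ * _ = 4 / delta * ((1 + g) ^+ t1 / n%:R + expR D ^+ t2 / n%:R)); last first.
  rewrite -mulrDl; move: (_ ^+ t1 + _ ^+ t2) (n%:R : R) n0 => x y y0.
  by clear -d0 y0; field; rewrite (gt_eqF d0) (gt_eqF y0).
apply: (@le_trans _ _ (4 / delta * (e * delta / 8 + e * delta / 8))).
  by rewrite ler_wpM2l ?divr_ge0 ?(ltW d0)// lerD.
rewrite le_eqVlt; apply/orP; left; apply/eqP; field; by rewrite gt_eqF.
Unshelve. all: by end_near.
Qed.

(** Markov's inequality over all n vertices replaces the late phase, so a zero escape probability is
    harmless: this serves pp at q = 1. *)
Lemma whp_pruned_early (R : realType) (q eps delta a c d : R) (pull : bool) :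
  0 < q -> q <= 1 -> 0 < eps -> eps < 1 ->
  0 < delta -> delta <= 1 / 4 -> delta <= eps -> 0 <= a ->
  a * ln (1 + growth q eps delta pull) < 1 -> c + d <= a ->
  whp_lower (rumour pull) q (fun n =>
      pruned_graph n (Num.truncn (delta * n%:R)) (Num.truncn (eps * n%:R)))
    (fun n => c * ln (n%:R) + d * ln (n%:R)).
Proof.
move=> q0 q1 e0 e1 d0 d14 de a0 aG cd.
set g := growth _ _ _ _ in aG *.
have g0 : 0 <= g by exact: growth_ge0.
apply: (@whp_lowerP _ _ _ _ a 0); rewrite ?addr0 ?(ltW q0)//.
  exact: rumour_increasing.
move=> e e'0; have := near_pruned_sizes e0 e1 d0 d14 de; apply: filter_app.
near=> n => -[[km mn kn k0 n2] [kinv sumk]] v0; rewrite mul0r truncn0 addn0.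
apply: (@le_trans _ _ ((1 + g) ^+ Num.truncn (a * ln (n%:R : R)) / n%:R)); last first.
  rewrite -[1 + g]lnK ?posrE//; last by lra.
  by near: n; apply: near_expR_truncn => //; apply: ln_ge0; lra.
apply: law_setT_le_card; rewrite ?(ltW q0)//; first by lra.
move=> v; apply: lerD; first by rewrite ler_piMr ?(ltW q0)// lern1 leq_b1.
rewrite ler_wpM2l// ler_wpM2l ?(ltW q0)//.
by apply: le_trans sumk; exact: pruned_pull_sum.
Unshelve. all: by end_near.
Qed.

(** * Deleting all edges *)

Definition empty_graph n : graph n :=
  @Graph n (fun _ _ => false) (fun _ _ => erefl) (fun _ => erefl).

Lemma deg_empty n (v : 'I_n) : deg (empty_graph n) v = 0%N.
Proof. by apply/eqP; rewrite /deg cards_eq0; apply/eqP/setP => u; rewrite !inE. Qed.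

Lemma whp_empty (R : realType) (q c d : R) (pull : bool) :
  0 < q -> q <= 1 ->
  whp_lower (rumour pull) q empty_graph (fun n => c * ln (n%:R) + d * ln (n%:R)).
Proof.
(* Durations must be nonnegative, while c + d is arbitrary. *)
move=> q0 q1; apply: (@whp_lowerP _ _ _ _ (Num.max (c + d) 0) 0);
  rewrite ?addr0 ?le_max ?lexx ?orbT ?(ltW q0)//.
  exact: rumour_increasing.
move=> e e0; near=> n => v0.
have n1 : e^-1 <= n%:R by near: n; exact: near_nat_ge.
have n0 : 0 < n%:R :> R by apply: lt_le_trans n1; rewrite invr_gt0.
set t := (_ + _)%N.
apply: (@le_trans _ _ ((1 + 0) ^+ t / n%:R)); last first.
  by rewrite addr0 expr1n div1r -[leRHS]invrK lef_pV2 ?posrE ?invr_gt0.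
apply: law_setT_le_card; rewrite ?(ltW q0) ?addr0// => v.
rewrite deg_empty mulr0 add0r big1 ?mulr0// => w _.
by rewrite mul0r.
Unshelve. all: by end_near.
Qed.

(** For s <= 1 the product grows by at most s (C + D + 1), and s <= w limits this to half of 1 - C
    D. The early phase is later shortened, and the late one lengthened, by [s]. *)
Lemma slack (R : realType) (A C D : R) :
  0 < A -> C * D < 1 -> 0 < C + D + 1 ->
  exists s, [/\ 0 < s, s < A & (C + s) * (D + s) < 1].
Proof.
move=> A0 CD S0; set w := (1 - C * D) / (2 * (C + D + 1)).
have w0 : 0 < w by rewrite divr_gt0 ?mulr_gt0//; lra.
exists (Num.min (Num.min 1 w) (A / 2)).
set s := Num.min _ _.
have s0 : 0 < s by rewrite !lt_min ltr01 w0 divr_gt0.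
have s1 : s <= 1 by rewrite !ge_min lexx.
have sw : s <= w by rewrite !ge_min lexx orbT.
have sA : s <= A / 2 by rewrite !ge_min lexx orbT.
split=> //; first by lra.
have : s * (2 * (C + D + 1)) <= 1 - C * D by rewrite -ler_pdivlMr// mulr_gt0.
by nra.
Qed.

Lemma exists_delta (R : realType) (q eps s : R) :
  0 < q -> 0 < eps -> eps < 1 -> 0 < s -> s < (ln (1 + 2 * q))^-1 ->
  exists delta, [/\ 0 < delta, delta <= 1 / 4, delta <= eps &
    ((ln (1 + 2 * q))^-1 - s) * ln (1 + growth q eps delta true) < 1].
Proof.
move=> q0 e0 e1 s0; set A := (ln (1 + 2 * q))^-1 => sA.
have As0 : 0 < A - s by lra.
(* The claim amounts to 1 + growth < H. Under pull, growth is 2 q + q K delta, and delta <= w uses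
   at most half of the gap H - (1 + 2 q). *)
set H := expR (A - s)^-1.
have HE : 1 + 2 * q < H.
  rewrite -[ltLHS]lnK ?posrE ?ltr_expR; last by lra.
  by rewrite -[ltLHS]invrK ltf_pV2 ?posrE// -/A; lra.
have K0 : 0 < 4 + (1 - eps)^-1 by rewrite addr_gt0// invr_gt0; lra.
set K := 4 + (1 - eps)^-1 in K0 *.
set w := (H - (1 + 2 * q)) / (2 * q * K).
have w0 : 0 < w by rewrite divr_gt0 ?mulr_gt0//; lra.
exists (Num.min (Num.min (1 / 4) w) eps); set d := Num.min _ _.
have d0 : 0 < d by rewrite !lt_min w0 e0 divr_gt0.
have dw : d <= w by rewrite !ge_min lexx orbT.
split=> //; [by rewrite !ge_min lexx|by rewrite !ge_min lexx orbT|].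
have g0 := growth_ge0 true q0 e1 d0.
have dK : d * (2 * q * K) <= H - (1 + 2 * q) by rewrite -ler_pdivlMr// !mulr_gt0.
have dK0 : 0 < d * (q * K) by rewrite !mulr_gt0.
rewrite -ltr_pdivlMl// mulr1 -[ltRHS]expRK ltr_ln ?posrE ?expR_gt0//; last by lra.
rewrite -/H /growth -/K mul1r; lra.
Qed.

(** * Numerical estimates for the pp rate *)

(** From exp (1/32) >= 33/32 by five squarings, rounded down each time. *)
Lemma expR1_lb (R : realType) : 265 / 100 <= expR 1 :> R.
Proof.
have step (a b y : R) : 0 <= a -> b <= a ^+ 2 -> a <= y -> b <= y ^+ 2.
  by move=> a0 ba ay; rewrite (le_trans ba)// lerXn2r ?nnegrE// (le_trans a0).
have -> : 1 = 32%:R * (1 / 32) :> R by lra.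
rewrite expRM_natl; set x := expR _.
have -> : x ^+ 32 = ((((x ^+ 2) ^+ 2) ^+ 2) ^+ 2) ^+ 2 by rewrite -!exprM.
apply: (step (163 / 100)); [lra|lra|].
apply: (step (1278 / 1000)); [lra|lra|].
apply: (step (1131 / 1000 - 3 / 10000)); [lra|lra|].
apply: (step (10634 / 10000)); [lra|lra|].
apply: (step (33 / 32)); [lra|lra|].
by apply: le_trans (expR_ge1Dx _); lra.
Qed.

(** Tangent of exp at 1, with e rounded down. *)
Lemma expR_tangent1 (R : realType) (y : R) : 0 <= y -> 265 / 100 * y <= expR y.
Proof.
move=> y0; rewrite -[y in expR y](subrK 1) expRD [leRHS]mulrC.
apply: ler_pM; [lra|by []|exact: expR1_lb|].
by apply: le_trans (expR_ge1Dx _); rewrite addrC subrK.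
Qed.

(** Tangent of exp at 2; 2.65^2 exceeds 7. *)
Lemma expR_tangent2 (R : realType) (y : R) : 1 <= y -> 7 * (y - 1) <= expR y.
Proof.
move=> y1; have -> : expR y = expR 1 * expR 1 * expR (y - 2).
  by rewrite -!expRD; congr expR; lra.
apply: ler_pM; [by []|by rewrite subr_ge0| |].
  apply: (@le_trans _ _ (265 / 100 * (265 / 100))); first by lra.
  by apply: ler_pM; [lra|lra|exact: expR1_lb|exact: expR1_lb].
apply: le_trans (expR_ge1Dx _); lra.
Qed.

(** Reduces upper bounds on the logarithm to lower bounds on exp. *)
Lemma oppr_ln_le (R : realType) (q y : R) : q < 1 -> 1 <= (1 - q) * expR y -> - ln (1 - q) <= y.
Proof.
move=> q1 h; have q1' : 0 < 1 - q by lra.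
have := ln_ge0 h; rewrite lnM ?posrE ?expR_gt0// expRK; lra.
Qed.

(** With X = q - ln (1 - q), the late duration 1 / (X - q eps) is convex in eps with slope q / X^2
    at 0; the coefficient of eps in the extra term must not exceed this slope. *)
Lemma pp_rate_ineq (R : realType) (q : R) : 0 < q -> q < 1 ->
  (1 / (8 * q) - q ^+ 3 / 5) * (q - ln (1 - q)) ^+ 2 <= q.
Proof.
move=> q0 q1; have p0 : 0 <= 1 - q by lra.
have L0 : 0 <= - ln (1 - q) by rewrite oppr_ge0 ln_le0//; lra.
suff h : (1 - 8 / 5 * q ^+ 4) * (q - ln (1 - q)) ^+ 2 <= 8 * q ^+ 2.
  rewrite -(ler_pM2l (_ : 0 < 8 * q)); last by rewrite mulr_gt0.
  rewrite (_ : 8 * q * (_ * _) = (1 - 8 / 5 * q ^+ 4) * (q - ln (1 - q)) ^+ 2).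
    by apply: le_trans h _; rewrite expr2 mulrA.
  by field; rewrite gt_eqF.
have sqX r : 0 <= r -> - ln (1 - q) <= r * q ->
    (q - ln (1 - q)) ^+ 2 <= (1 + r) ^+ 2 * q ^+ 2.
  move=> r0 Lr; rewrite -exprMn lerXn2r ?nnegrE ?mulr_ge0 ?addr_ge0 ?(ltW q0)//.
  by rewrite mulrDl mul1r lerD2l.
have X0 := sqr_ge0 (q - ln (1 - q)); have Y0 := sqr_ge0 q.
have Q0 : 0 <= q ^+ 4 by rewrite exprn_ge0// ltW.
(* Up to 7/10, - ln (1 - q) <= 1.82 q suffices, as 2.82^2 < 8. It follows from exp y >= 1 + y up to
   0.44 and from the tangent at 1 beyond. *)
have [q7|q7] := leP q (7 / 10).
  apply: (@le_trans _ _ ((q - ln (1 - q)) ^+ 2)).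
    by rewrite ler_piMl//; clear -Q0; move: (q ^+ 4) Q0 => Q; lra.
  apply: le_trans (sqX (182 / 100) _ _) _; first by clear; lra.
    have y0 : 0 <= 182 / 100 * q by clear -q0; lra.
    apply: oppr_ln_le => //; have [q4|q4] := leP q (44 / 100).
      apply: le_trans (ler_wpM2l p0 (expR_ge1Dx _)).
      have : 0 <= q * (44 / 100 - q) by rewrite mulr_ge0 ?subr_ge0 ?(ltW q0).
      by clear -q0; lra.
    apply: le_trans (ler_wpM2l p0 (expR_tangent1 y0)).
    have : 0 <= (q - 44 / 100) * (7 / 10 - q) by rewrite mulr_ge0 ?subr_ge0 ?(ltW q4).
    by clear -q4 q7; lra.
  by apply: ler_wpM2r => //; clear; lra.
have q4 : (7 / 10) ^+ 4 <= q ^+ 4.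
  by apply: lerXn2r; [rewrite nnegrE; clear; lra|rewrite nnegrE ltW|exact: ltW].
(* From q^4 = 5/8 on, the factor 1 - 8/5 q^4 is not positive. *)
have [q8|q8] := leP (5 / 8) (q ^+ 4).
  apply: (@le_trans _ _ 0); last by rewrite mulr_ge0.
  by rewrite mulr_le0_ge0//; clear -q8; move: (q ^+ 4) q8 => Q q8; lra.
have q89 : q < 8892 / 10000.
  rewrite ltNge; apply/negP => h.
  have : (8892 / 10000) ^+ 4 <= q ^+ 4.
    by apply: lerXn2r; [rewrite nnegrE; clear; lra|rewrite nnegrE ltW|exact: h].
  by clear -q8; move: (q ^+ 4) q8 => Q q8; lra.
(* On the remaining range the tangent at 2 gives - ln (1 - q) <= 2.58 q; the first factor is below
   0.616, and 0.616 times 3.58^2 is below 8. *)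
have X1 : (q - ln (1 - q)) ^+ 2 <= (1 + 258 / 100) ^+ 2 * q ^+ 2.
  apply: sqX; first by clear; lra.
  apply: oppr_ln_le => //; apply: (@le_trans _ _ ((1 - q) * (7 * (258 / 100 * q - 1)))).
    have : 0 <= (q - 7 / 10) * (8892 / 10000 - q) by rewrite mulr_ge0 ?subr_ge0 ?(ltW q7) ?(ltW q89).
    by clear -q7 q89; lra.
  by apply: ler_wpM2l => //; apply: expR_tangent2; clear -q7; lra.
apply: (@le_trans _ _ ((1 - 8 / 5 * (7 / 10) ^+ 4) * (q - ln (1 - q)) ^+ 2)).
  apply: ler_wpM2r; first exact: X0.
  by clear -q4; move: (q ^+ 4) q4 => Q q4; lra.
clear -X1 Y0; move: (_ ^+ 2) X1 => X; move: (q ^+ 2) Y0 => Y; lra.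
Qed.

(** * Choice of the parameters *)

Lemma c_pushE (R : realType) (q : R) : q <= 1 -> c_push q = (ln (1 + q))^-1 + q^-1.
Proof. by rewrite le_eqVlt /c_push => /orP[/eqP ->|->//]; rewrite ltxx invr1. Qed.

(** For push, [growth] is q whatever delta is, so the delta found for pp serves both protocols. *)
Lemma whp_push_pruned (R : realType) (q eps delta : R) :
  0 < q -> q <= 1 -> 0 < eps -> eps < 1 ->
  0 < delta -> delta <= 1 / 4 -> delta <= eps ->
  whp_lower push q (fun n =>
      pruned_graph n (Num.truncn (delta * n%:R)) (Num.truncn (eps * n%:R)))
    (fun n => c_push q * ln (n%:R) + eps / (2 * q) * ln (n%:R)).
Proof.
move=> q0 q1 e0 e1 d0 d14 de.
have lq : 0 < ln (1 + q) by rewrite ln_gt0//; lra.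
have q'0 : 0 < q^-1 by rewrite invr_gt0.
set C := q^-1 + eps / (2 * q).
have C0 : 0 < C by rewrite addr_gt0// divr_gt0// mulr_gt0.
have D0 : 0 < q * (1 - eps) by rewrite mulr_gt0//; lra.
(* The product equals 1 - eps / 2 - eps^2 / 2. *)
have CD : C * (q * (1 - eps)) < 1.
  rewrite (_ : C * _ = (1 + eps / 2) * (1 - eps)).
    by have := mulr_gt0 e0 e0; lra.
  by rewrite /C; field; rewrite gt_eqF.
have [||s [s0 sA Cs]] := @slack R (ln (1 + q))^-1 C (q * (1 - eps)) _ CD.
- by rewrite invr_gt0.
- by lra.
apply: (@whp_pruned _ _ _ _ s ((ln (1 + q))^-1 - s) (C + s) _ _ false) => //.
- by lra.
- by lra.
- by rewrite /growth mul0r addr0 mulrBl mulVf ?gt_eqF// ltrBlDr ltrDl mulr_gt0.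
- by rewrite mul0r subr0 ln1 subr0.
- by rewrite c_pushE// /C; lra.
Qed.

Lemma exists_whp_pp_pruned (R : realType) (q eps : R) :
  0 < q -> q <= 1 -> 0 < eps -> eps < 1 ->
  exists delta, [/\ 0 < delta, delta <= 1 / 4, delta <= eps &
    whp_lower pp q (fun n =>
        pruned_graph n (Num.truncn (delta * n%:R)) (Num.truncn (eps * n%:R)))
      (fun n => c_pp q * ln (n%:R)
                + (eps / (8 * q) - eps * q ^+ 3 / 5) * ln (n%:R))].
Proof.
move=> q0 q1 e0 e1.
have lq : 0 < ln (1 + 2 * q) by rewrite ln_gt0//; lra.
have A0 : 0 < (ln (1 + 2 * q))^-1 by rewrite invr_gt0.
have [qlt|qge] := ltP q 1; last first.
  have {qge} q1E : q = 1 by apply/eqP; rewrite eq_le q1 qge.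
  (* At q = 1 the extra coefficient is eps / 8 - eps / 5 = - 3/40 eps; the early phase may be
     shortened by that much. *)
  pose s := Num.min (3 / 40 * eps) ((ln (1 + 2 * q))^-1 / 2).
  have s0 : 0 < s by rewrite lt_min !mulr_gt0.
  have se : s <= 3 / 40 * eps by rewrite ge_min lexx.
  have sA : s <= (ln (1 + 2 * q))^-1 / 2 by rewrite ge_min lexx orbT.
  have [|delta [d0 d14 de aG]] := exists_delta q0 e0 e1 s0; first by lra.
  exists delta; split=> //.
  apply: (@whp_pruned_early _ _ _ _ ((ln (1 + 2 * q))^-1 - s) _ _ true) => //.
    by lra.
  rewrite /c_pp q1E ltxx (_ : 1 + 2 * 1 = 3); last by lra.
  rewrite expr1n; lra.
have lq' : ln (1 - q) < 0 by rewrite ln_lt0//; lra.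
set X := q - ln (1 - q); have X0 : 0 < X by rewrite /X; lra.
set B := 1 / (8 * q) - q ^+ 3 / 5.
have BX : B * X ^+ 2 <= q by exact: pp_rate_ineq.
have XX : X * X^-1 = 1 by rewrite mulfV// gt_eqF.
have X'0 : 0 < X^-1 by rewrite invr_gt0.
set C := X^-1 + eps * B.
(* The product is 1 + eps (B (X - q eps) - q / X); the bracket is negative since B X <= q / X. *)
have CD : C * (X - q * eps) < 1.
  have qX : 0 < q * X^-1 by rewrite mulr_gt0.
  have qe : 0 < q * eps by rewrite mulr_gt0.
  have Xqe : 0 < X - q * eps by rewrite /X; nra.
  have BX' : B * X <= q * X^-1.
    have := ler_wpM2r (ltW X'0) BX.
    by rewrite expr2 -!mulrA XX mulr1.
  have : B * (X - q * eps) < q * X^-1.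
    have [B0|B0] := leP B 0; first by nra.
    by apply: lt_le_trans BX'; rewrite ltr_pM2l//; lra.
  rewrite -(ltr_pM2l e0) => h.
  rewrite (_ : C * _ = X * X^-1 + (eps * (B * (X - q * eps)) - eps * (q * X^-1))).
    by rewrite XX; lra.
  by rewrite /C; ring.
have CD0 : 0 < C + (X - q * eps) + 1.
  have q3 : q ^+ 3 <= 1 by rewrite exprn_ile1// ltW.
  have B5 : - (1 / 5) <= B.
    have : 0 < 1 / (8 * q) by rewrite divr_gt0// mulr_gt0.
    by rewrite /B; lra.
  have : 0 < X - q * eps by rewrite /X; nra.
  by rewrite /C; nra.
have [s [s0 sA Cs]] := slack A0 CD CD0.
have [delta [d0 d14 de aG]] := exists_delta q0 e0 e1 s0 sA.
exists delta; split=> //.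
(* For q near 1 the constant [C] can be negative, which a duration cannot be. *)
apply: (@whp_pruned _ _ _ _ s ((ln (1 + 2 * q))^-1 - s) (Num.max (C + s) 0) _ _ true) => //.
- by lra.
- by rewrite le_max lexx orbT.
- rewrite mul1r (_ : _ - _ + s = X - q * eps + s); last by rewrite /X; lra.
  have [Cs0|Cs0] := leP (C + s) 0; first by rewrite mul0r.
  by [].
- have CC : C + s <= Num.max (C + s) 0 by rewrite le_max lexx.
  rewrite /c_pp qlt -/X.
  have -> : eps / (8 * q) - eps * q ^+ 3 / 5 = eps * B.
    by rewrite /B; field; rewrite gt_eqF.
  by move: CC; rewrite /C; lra.
Qed.

Theorem theorem1p6 (R : realType) (eps q : R) :
  0 < eps -> 0 < q -> q <= 1 ->
  exists (G Gt : forall n, graph n),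
    expander_seq R G /\
    (forall n, keeps_fraction eps (G n) (Gt n)) /\
    whp_lower push q Gt
      (fun n => c_push q * ln (n%:R) + eps / (2 * q) * ln (n%:R)) /\
    whp_lower pp q Gt
      (fun n => c_pp q * ln (n%:R)
                + (eps / (8 * q) - eps * q ^+ 3 / 5) * ln (n%:R)).
Proof.
move=> e0 q0 q1; exists complete_graph.
have [e1|e1] := leP 1 eps.
  exists empty_graph; split; first exact: complete_expander.
  split; first by move=> n; split=> // v; apply: (@le_trans _ _ 0) => //;
    rewrite mulr_le0_ge0// subr_le0.
  by split; [exact: (whp_empty _ _ false)|exact: (whp_empty _ _ true)].
have [delta [d0 d14 de pp_slow]] := exists_whp_pp_pruned q0 q1 e0 e1.
exists (fun n =>
  pruned_graph n (Num.truncn (delta * n%:R)) (Num.truncn (eps * n%:R))).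
split; first exact: complete_expander.
split; last by split=> //; exact: whp_push_pruned.
move=> n; have dn0 : 0 <= eps * n%:R by rewrite mulr_ge0// ltW.
have /andP[m1 _] := truncn_itv dn0.
apply: pruned_keeps_fraction; rewrite ?(ltW e0) ?(ltW e1)//.
  by apply: le_truncn; rewrite ler_wpM2r.
by rewrite -(ler_nat R) (le_trans m1)// ler_piMl// ltW.
Qed.
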